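(* Let $H$ be a nonzero real Hilbert space, let $1<p\le 2$, let $n\ge 1$, and let $X_1,\ldots,X_n$ be independent copies of an $H$-valued random vector with mean $\mu$. Fix a deterministic anchor $a\in H$ and $\tau>0$, and assume $$M_a=\mathbb{E}\lVert X_1-a\rVert^p<\infty .$$ Define $$\widehat\mu_{a,\tau}=a+\frac1n\sum_{i=1}^n C_\tau(X_i-a).$$ Then, for all $\alpha,\beta\ge 0$, $$\alpha\,\lVert\mathbb{E}\widehat\mu_{a,\tau}-\mu\rVert+\frac{\beta}{\tau}\,\mathbb{E}\lVert\widehat\mu_{a,\tau}-\mathbb{E}\widehat\mu_{a,\tau}\rVert^2\le K_p\!\left(\alpha,\frac{\beta}{n}\right)\tau^{1-p}M_a .$$ The constant is the smallest possible uniform constant over this class: for every fixed nonzero real Hilbert space $H$, every fixed $1<p\le 2$, integer $n\ge 1$, $\tau>0$ and $\alpha,\beta\ge 0$, if $K\in\mathbb{R}$ is such that $$\alpha\,\lVert\mathbb{E}\widehat\mu_{a,\tau}-\mu\rVert+\frac{\beta}{\tau}\,\mathbb{E}\lVert\widehat\mu_{a,\tau}-\mathbb{E}\widehat\mu_{a,\tau}\rVert^2\le K\,\tau^{1-p}M_a$$ for all anchors $a\in H$ and all i.i.d. $X_1,\ldots,X_n$ (on arbitrary probability spaces) with $\mathbb{E}\lVert X_1-a\rVert^p<\infty$, then $K\ge K_p(\alpha,\beta/n)$. The phase boundary of this constant, i.e. the boundary between the two branches in the definition of $K_p(\alpha,\beta/n)$, is $\alpha=p\beta/n$.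
   Context: Random vectors in $H$ are strongly measurable, and $H$-valued expectations are Bochner expectations. For $\tau>0$, radial clipping is the map $C_\tau:H\to H$ with $C_\tau(x)=x$ if $\lVert x\rVert\le\tau$ and $C_\tau(x)=\tau x/\lVert x\rVert$ if $\lVert x\rVert>\tau$. For $1<p\le 2$ put $c_p=\dfrac{(p-1)^{p-1}}{p^p}$. For $\alpha,\beta\ge 0$ define $$K_p(\alpha,\beta)=\begin{cases}\beta,&\alpha\le p\beta,\\ c_p\,\dfrac{\alpha^p}{(\alpha-\beta)^{p-1}},&\alpha>p\beta.\end{cases}$$ *)

(* Defs.v *)
From HB Require Import structures.
From mathcomp Require Import all_boot all_order all_algebra.
From mathcomp Require Import all_classical all_reals all_analysis.
Import Order.TTheory GRing.Theory Num.Theory.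
Import numFieldNormedType.Exports.

Set Implicit Arguments.
Unset Strict Implicit.
Unset Printing Implicit Defensive.

Local Open Scope classical_set_scope.
Local Open Scope ring_scope.

Section bochner.
Context (R : realType) (H : completeNormedModType R).
Context (d : measure_display) (T : measurableType d) (P : probability T R).

(* The library's {sfun T >-> R} is restricted to real values. *)
Definition simple_vector (s : T -> H) : Prop :=
  finite_set (range s) /\ forall y : H, measurable (s @^-1` [set y]).

Definition strongly_measurable (f : T -> H) : Prop :=
  exists s : nat -> T -> H,
    (forall k, simple_vector (s k)) /\
    (forall w, (fun k => s k w) @ \oo --> f w).

Definition simple_mean (s : T -> H) : H :=
  \sum_(y \in range s) fine (P (s @^-1` [set y])) *: y.

(* [f] is Bochner integrable and its Bochner integral is [m]. *)
Definition has_mean (f : T -> H) (m : H) : Prop :=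
  strongly_measurable f /\
  exists s : nat -> T -> H,
    [/\ forall k, simple_vector (s k),
        (fun k => 'E_P[fun w => `|f w - s k w|%R]%E) @ \oo --> 0%E
      & (fun k => simple_mean (s k)) @ \oo --> m].

(* The default value [0] is only returned when [f] is not Bochner
   integrable; [m] in [has_mean f m] is unique. *)
Definition bochner_mean (f : T -> H) : H := xget 0 [set m | has_mean f m].

Definition borel_set (B : set H) : Prop := <<s @open H >> B.

Definition mutually_independent (n : nat) (X : 'I_n -> T -> H) : Prop :=
  forall (J : {set 'I_n}) (B : 'I_n -> set H),
    (forall i, borel_set (B i)) ->
    P (\bigcap_(i in [set` J]) (X i @^-1` B i)) =
    (\prod_(i in J) P (X i @^-1` B i))%E.

Definition identically_distributed (n : nat) (X : 'I_n -> T -> H) : Prop :=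
  forall (i j : 'I_n) (B : set H), borel_set B ->
    P (X i @^-1` B) = P (X j @^-1` B).

Definition iid_vectors (n : nat) (X : 'I_n -> T -> H) : Prop :=
  [/\ forall i, strongly_measurable (X i),
      mutually_independent X
    & identically_distributed X].

End bochner.

Section clipping.
Context (R : realType) (H : completeNormedModType R).

Definition clip (tau : R) (x : H) : H :=
  if `|x| <= tau then x else (tau / `|x|) *: x.

Definition clipped_mean (T : Type) (n : nat) (X : 'I_n -> T -> H)
    (a : H) (tau : R) : T -> H :=
  fun w => a + n%:R^-1 *: \sum_(i < n) clip tau (X i w - a).

Context (d : measure_display) (T : measurableType d) (P : probability T R).

Definition anchored_moment (p : R) (a : H) (Y : T -> H) : \bar R :=
  'E_P[fun w => (`|Y w - a| `^ p)%R]%E.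

Definition weighted_risk (n : nat) (X : 'I_n -> T -> H) (mu a : H)
    (tau alpha beta : R) : \bar R :=
  let muhat := clipped_mean X a tau in
  let mean := bochner_mean P muhat in
  ((alpha * `|mean - mu|)%:E +
   (beta / tau)%:E * 'E_P[fun w => (`|muhat w - mean| ^+ 2)%R])%E.

End clipping.

Section constant.
Context (R : realType).

Definition c_ (p : R) : R := (p - 1) `^ (p - 1) / p `^ p.

Definition first_branch (p alpha beta : R) : bool := alpha <= p * beta.

Definition K_ (p alpha beta : R) : R :=
  if first_branch p alpha beta then beta
  else c_ p * (alpha `^ p / (alpha - beta) `^ (p - 1)).

Definition quadrant : set (R * R) := [set x | 0 <= x.1 /\ 0 <= x.2].

(* Boundary, relative to the parameter domain [quadrant], between the regions
   of (alpha, beta) on which [K_ p alpha (beta / n)] uses each branch; the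
   quadrant is closed, so closures may be taken in the plane. *)
Definition phase_boundary (p : R) (n : nat) : set (R * R) :=
  closure (quadrant `&` [set x | first_branch p x.1 (x.2 / n%:R)]) `&`
  closure (quadrant `&` [set x | ~~ first_branch p x.1 (x.2 / n%:R)]).

End constant.

(* Main.v *)
Require Import Defs.
From HB Require Import structures.
From mathcomp Require Import finmap.
From mathcomp Require Import all_boot all_order all_algebra.
From mathcomp Require Import all_classical all_reals all_analysis measurable_realfun.
From mathcomp Require Import ring lra.
Import Order.TTheory GRing.Theory Num.Theory.
Import numFieldNormedType.Exports.

Local Open Scope classical_set_scope.
Local Open Scope ring_scope.

Set Implicit Arguments.
Unset Strict Implicit.
Unset Printing Implicit Defensive.

(** Let [Z = X_1 - a], let [Y] be [Z] clipped at [tau], and let [m] be the mean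
    of [Y]. The mean of the estimator is [a + m], and since the clipped
    increments are independent copies of [Y], its variance is
    [(E `|Y| ^+ 2 - `|m| ^+ 2) / n] (lemma [weighted_riskE]). The risk is
    therefore an explicit function of the law of [Z].

    Upper bound. The bias [`|a + m - mu|] is the norm of the mean of [Y - Z],
    so it is at most the expectation of the positive part of [`|Z| - tau]; the
    variance is at most [E (min `|Z| tau) ^+ 2 / n]. With [b = beta / n] and
    [s = `|Z| / tau] it remains to integrate the scalar inequality

      [alpha * max (s - 1) 0 + b * (min s 1) ^+ 2 <= K_ p alpha b * s `^ p]

    (lemma [clipped_scalar_bound]). For [s >= 1] it says that [K_ p alpha b] is
    the maximum of [(alpha * (s - 1) + b) / s `^ p]: this maximum is reached at
    [s = 1] if [alpha <= p * b], and otherwise at an explicit larger [s], where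
    the affine numerator is tangent to a multiple of [s `^ p].

    Sharpness. If [X_1] is [s * tau] times a unit vector with probability [q]
    and [0] otherwise, any admissible [K] satisfies
    [alpha * (s - 1) + b * (1 - q) <= K * s `^ p]
    (lemma [two_point_bound]). Letting [q] tend to [0] at the maximising [s]
    gives [K_ p alpha b <= K].

    Vector-valued integration is reduced to real integrals. A Bochner mean [m]
    of [f] satisfies [E <f, z> = <m, z>] for all [z], which determines it
    ([has_mean_weak], [ip_inj]) and bounds its norm ([norm_weak_mean]); a bounded
    strongly measurable function has a Bochner mean by dominated convergence and
    completeness ([bounded_has_mean]). Orthogonality of independent centred
    vectors ([ip_independent]) is obtained by replacing their values by nearest
    points in finite subsets of a sequence dense in the range, which gives
    simple functions that are still independent. *)

(** * Scalar inequalities and the phase boundary *)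

Section scalar_constant.
Context (R : realType).
Implicit Types p alpha b s x : R.

(** Bernoulli's inequality for real exponents, from [1 + y <= expR y] at
    [y = (p - 1) * ln x] and [1 - 1/x <= ln x]. *)
Lemma powR_bernoulli p x : 1 <= p -> 0 <= x -> 1 + p * (x - 1) <= x `^ p.
Proof.
move=> p1; rewrite le0r => /orP[/eqP ->|x0].
  by rewrite powR0; [lra|apply/eqP; lra].
have x0' : x != 0 by rewrite gt_eqF.
rewrite -mulr_powRB1 ?(ltW x0)//; last by lra.
have lnx : 1 - x^-1 <= ln x.
  rewrite -lerN2 -lnV ?posrE// opprB.
  have := @le_ln1Dx R (x^-1 - 1); rewrite [1 + _]addrCA subrr addr0; apply.
  by rewrite ltrBrDl subrr invr_gt0.
have : 1 + (p - 1) * ln x <= x `^ (p - 1).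
  by rewrite /powR (negbTE x0'); exact: expR_ge1Dx.
move=> /(le_trans _) h; have {h} := h (1 + (p - 1) * (1 - x^-1)).
rewrite lerD2l ler_wpM2l ?subr_ge0// => /(_ isT).
rewrite -(ler_pM2l x0); apply: le_trans.
by rewrite le_eqVlt; apply/orP; left; apply/eqP; field.
Qed.

(** The maximiser over [s >= 1] of [(alpha * (s - 1) + b) / s `^ p] when
    [p * b < alpha]; otherwise the maximum is at [s = 1]. *)
Definition critical_scale p alpha b := p * (alpha - b) / ((p - 1) * alpha).

Lemma critical_scale_ge1 p alpha b : 1 < p -> 0 <= b -> p * b < alpha ->
  1 <= critical_scale p alpha b.
Proof.
move=> p1 b0 ab; have a0 : 0 < alpha by nra.
by rewrite /critical_scale ler_pdivlMr ?mulr_gt0 ?subr_gt0//; lra.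
Qed.

Lemma K_critical p alpha b : 1 < p -> 0 <= b -> p * b < alpha ->
  K_ p alpha b * critical_scale p alpha b `^ p = (alpha - b) / (p - 1).
Proof.
move=> p1 b0 ab; have a0 : 0 < alpha by nra.
have ba : 0 < alpha - b by rewrite subr_gt0; nra.
have q0 : 0 < p - 1 by rewrite subr_gt0.
have p0 : 0 < p by lra.
rewrite /K_ /first_branch leNgt ab /= /c_ /critical_scale.
have powRV z : 0 < z -> z^-1 `^ p = (z `^ p)^-1.
  by move=> z0; rewrite -(@powR_inv1 _ z) ?ltW// -powRrM mulN1r powRN.
rewrite !powRM ?invr_ge0 ?mulr_ge0 ?ltW// powRV ?mulr_gt0// powRM ?ltW//.
rewrite -[(alpha - b) `^ p]mulr_powRB1 ?ltW//.
rewrite -[(p - 1) `^ p]mulr_powRB1 ?ltW//.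
have h1 := powR_gt0 (p - 1) q0; have h2 := powR_gt0 p p0.
have h3 := powR_gt0 p a0; have h4 := powR_gt0 (p - 1) ba.
by field; rewrite !gt_eqF.
Qed.

(** [K_ p alpha b] is the maximum of [(alpha * (s - 1) + b) / s `^ p] over
    [s >= 1]: the affine function lies below the tangent line of
    [K_ p alpha b * s `^ p] at the maximiser, so Bernoulli's inequality
    applies after rescaling by it. *)
Lemma tangent_bound p alpha b s : 1 < p -> 0 <= alpha -> 0 <= b -> 1 <= s ->
  alpha * (s - 1) + b <= K_ p alpha b * s `^ p.
Proof.
move=> p1 a0 b0 s1; have [ab|ab] := leP alpha (p * b).
  rewrite /K_ /first_branch ab.
  have := powR_bernoulli (ltW p1) (le_trans ler01 s1).
  move=> /(ler_wpM2l b0); apply: le_trans.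
  by have := ler_wpM2r (_ : 0 <= s - 1) ab; rewrite subr_ge0 => /(_ s1); lra.
have ba : 0 < alpha - b by rewrite subr_gt0; nra.
have q0 : 0 < p - 1 by rewrite subr_gt0.
have a0' : 0 < alpha by nra.
have s0 : 0 <= s by lra.
have c0 := lt_le_trans ltr01 (critical_scale_ge1 p1 b0 ab).
have Kc := K_critical p1 b0 ab.
set c := critical_scale p alpha b in c0 Kc.
rewrite -[s in s `^ p](divfK (lt0r_neq0 c0)) powRM ?(ltW c0) ?(divr_ge0 s0 (ltW c0))//.
rewrite mulrCA Kc [leRHS]mulrC.
have := @powR_bernoulli p (s / c) (ltW p1).
rewrite (divr_ge0 s0 (ltW c0)) => /(_ isT).
move=> /(ler_wpM2l (ltW (divr_gt0 ba q0))); apply: le_trans.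
rewrite le_eqVlt; apply/orP; left; apply/eqP; rewrite /c /critical_scale.
have p0 : 0 < p by lra.
by field; rewrite !gt_eqF.
Qed.

(** The inequality to be integrated, with [s] standing for the distance to the
    anchor in units of the clipping radius. For [s < 1] only the variance term
    remains, and [s ^+ 2 <= s `^ p] because [p <= 2]. *)
Lemma clipped_scalar_bound p alpha b s :
  1 < p -> p <= 2 -> 0 <= alpha -> 0 <= b -> 0 <= s ->
  alpha * Num.max (s - 1) 0 + b * Num.min s 1 ^+ 2 <= K_ p alpha b * s `^ p.
Proof.
move=> p1 p2 a0 b0 s0; have [s1|s1] := leP 1 s.
  rewrite max_l ?subr_ge0// expr1n mulr1.
  exact: tangent_bound.
rewrite max_r ?subr_le0 ?(ltW s1)// mulr0 add0r.
(* the tangent bound at s = 1 *)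
have bK : b <= K_ p alpha b.
  by have := @tangent_bound p alpha b 1 p1 a0 b0 (lexx _); rewrite powR1; lra.
apply: (@le_trans _ _ (b * s `^ p)); last by rewrite ler_wpM2r// powR_ge0.
rewrite ler_wpM2l// -powR_mulrn//; have [->|s_neq0] := eqVneq s 0.
  by rewrite !powR0 ?pnatr_eq0//; apply/eqP; lra.
by rewrite ger_powR// lt0r s_neq0 s0 ltW.
Qed.

(** The scale used by the extremal two-point law. *)
Lemma tangent_attained p alpha b : 1 < p -> 0 <= b ->
  exists2 s, 1 <= s & alpha * (s - 1) + b = K_ p alpha b * s `^ p.
Proof.
move=> p1 b0; have [ab|ab] := leP alpha (p * b).
  exists 1; first by [].
  by rewrite /K_ /first_branch ab powR1; ring.
exists (critical_scale p alpha b); first exact: critical_scale_ge1.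
have a0' : 0 < alpha by nra.
have q0 : 0 < p - 1 by rewrite subr_gt0.
by rewrite K_critical// /critical_scale; field; rewrite !gt_eqF.
Qed.

Lemma phase_boundaryE p (n : nat) : 0 < p -> (0 < n)%N ->
  phase_boundary p n =
    [set x : R * R | [/\ 0 <= x.1, 0 <= x.2 & x.1 = p * x.2 / n%:R]].
Proof.
move=> p0 n0; have cx : continuous (fun x : R * R => x.1) by move=> x; exact: cvg_fst.
have cy : continuous (fun x : R * R => x.2) by move=> x; exact: cvg_snd.
have cl : continuous (fun x : R * R => p * x.2 / n%:R).
  by move=> x; apply: cvgM; [apply: cvgM; [exact: cvg_cst|exact: cy]|exact: cvg_cst].
have cld (f g : R * R -> R) : continuous f -> continuous g ->
    closed [set x | f x <= g x].
  move=> cf cg; rewrite (_ : mkset _ = (fun x : R * R => g x - f x) @^-1` [set y | 0 <= y]).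
    apply: closed_comp; last exact: closed_ge.
    by move=> z _; apply: cvgB; [exact: cg|exact: cf].
  by apply/seteqP; split => x /=; rewrite subr_ge0.
have c0 : continuous (fun _ : R * R => 0 : R) by move=> x; exact: cvg_cst.
have cls (A B : set (R * R)) z : closed B -> A `<=` B -> closure A z -> B z.
  by move=> cB AB /(closure_subset AB); rewrite -(iffLR (closure_id _) cB).
apply/seteqP; split => -[x y] /=.
  move=> [h1 h2].
  have cq : closed (@quadrant R).
    rewrite (_ : @quadrant R = [set x | 0 <= x.1] `&` [set x | 0 <= x.2]); last by [].
    by apply: closedI; exact: cld.
  have [q1 l1] : (@quadrant R `&` [set x | x.1 <= p * x.2 / n%:R]) (x, y).
    apply: cls h1; [by apply: closedI => //; exact: cld|apply: setIS] => z /=.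
    by rewrite /first_branch mulrA.
  have [_ l2] : (@quadrant R `&` [set x | p * x.2 / n%:R <= x.1]) (x, y).
    apply: cls h2; [by apply: closedI => //; exact: cld|apply: setIS] => z /=.
    by rewrite /first_branch mulrA -ltNge => /ltW.
  by case: q1 => /= x0 y0; split => //; apply/eqP; rewrite eq_le l1 l2.
move=> [x0 y0 xy]; split.
  by apply: subset_closure; split => //=; rewrite /first_branch mulrA xy.
(* boundary points are limits of (x + t, y), t -> 0+, on the second branch *)
move=> B /= [[U V] [/= Ux Vy] UVB].
have [e /= e0 eU] := iffLR (nbhs_ballP _ _) Ux.
exists (x + e / 2, y); split; last first.
  apply: UVB; split => /=; last exact: nbhs_singleton.
  apply: eU; rewrite /ball /= opprD addNKr normrN gtr0_norm ?divr_gt0//.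
  by rewrite ltr_pdivrMr// mulrDr mulr1 ltrDl.
split; first by split => //=; rewrite addr_ge0// divr_ge0// ltW.
by rewrite /= /first_branch mulrA -ltNge xy ltrDl divr_gt0.
Qed.

End scalar_constant.

(** * Inner products and radial clipping *)

Section inner_product.
Context (R : realType) (H : completeNormedModType R).
Variables (ip : {dot H for (@idfun R)}).
Hypothesis ip_norm : forall x : H, ip x x = `|x| ^+ 2.
Implicit Types (x y z : H).

Lemma ipC x y : ip x y = ip y x.
Proof. by rewrite hermC /= expr0 mul1r. Qed.

Lemma ipDl x y z : ip (x + y) z = ip x z + ip y z.
Proof. exact: linearDl. Qed.

Lemma ipZl (c : R) x z : ip (c *: x) z = c * ip x z.
Proof. exact: linearZl_LR. Qed.

Lemma ipBl x y z : ip (x - y) z = ip x z - ip y z.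
Proof. exact: linearBl. Qed.

Lemma ip0l z : ip 0 z = 0.
Proof. exact: linear0l. Qed.

Lemma ipZr (c : R) x z : ip x (c *: z) = c * ip x z.
Proof. by rewrite ipC ipZl ipC. Qed.

Lemma ipBr x y z : ip x (y - z) = ip x y - ip x z.
Proof. by rewrite ipC ipBl !(ipC x). Qed.

Lemma ip_suml (I : Type) (r : seq I) (F : I -> H) z :
  ip (\sum_(i <- r) F i) z = \sum_(i <- r) ip (F i) z.
Proof. by elim/big_rec2: _ => [|i u v _ <-]; rewrite ?ip0l ?ipDl. Qed.

Lemma ip_sumr (I : Type) (r : seq I) (F : I -> H) z :
  ip z (\sum_(i <- r) F i) = \sum_(i <- r) ip z (F i).
Proof. by rewrite ipC ip_suml; under eq_bigr do rewrite ipC. Qed.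

Lemma ip_le x y : `|ip x y| <= `|x| * `|y|.
Proof.
(* nonnegativity of |a x - b y|^2, used at a = |y|^2 and b = <x, y> *)
have pos a b : 0 <= a ^+ 2 * `|x| ^+ 2 - a * b * ip x y *+ 2 + b ^+ 2 * `|y| ^+ 2.
  apply: le_trans (sqr_ge0 `|a *: x - b *: y|) _.
  by rewrite -(ip_norm (_ - _)) !(ipBl, ipBr, ipZl, ipZr) !ip_norm (ipC y x); lra.
rewrite -(ler_pXn2r (_ : (0 < 2)%N)) ?nnegrE ?mulr_ge0//.
rewrite real_normK ?num_real// exprMn.
have [y0|y0] := eqVneq `|y| 0.
  have yE : y = 0 by apply/eqP; rewrite -normr_eq0 y0.
  by rewrite yE ipC ip0l normr0 !expr0n /= mulr0.
have := pos (`|y| ^+ 2) (ip x y); have y2 : 0 < `|y| ^+ 2 by rewrite exprn_gt0// lt0r y0 /=.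
rewrite (_ : _ + _ = `|y| ^+ 2 * (`|x| ^+ 2 * `|y| ^+ 2 - ip x y ^+ 2)); last by ring.
by rewrite pmulr_rge0// subr_ge0.
Qed.

Lemma ip_inj x y : (forall z, ip x z = ip y z) -> x = y.
Proof.
move=> h; apply/subr0_eq/eqP; rewrite -normr_eq0 -sqrf_eq0 -ip_norm.
by rewrite ipBl h subrr.
Qed.

Lemma ip_continuous z : continuous (fun x => ip x z).
Proof.
move=> x; apply/cvgrPdist_le => e e0.
have z0 : 0 < `|z| + 1 by rewrite ltr_wpDl.
near=> y; rewrite -ipBl; apply: le_trans (ip_le _ _) _.
apply: (@le_trans _ _ (`|x - y| * (`|z| + 1))).
  by rewrite ler_wpM2l// lerDl.
rewrite -ler_pdivlMr//; near: y.
by apply: cvgr_dist_le; [exact: cvg_id|rewrite divr_gt0].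
Unshelve. all: by end_near. Qed.

Lemma sqr_normB x y : `|x - y| ^+ 2 = `|x| ^+ 2 - ip x y *+ 2 + `|y| ^+ 2.
Proof. by rewrite -!ip_norm ipBl !ipBr (ipC y x); ring. Qed.

End inner_product.

Section clip.
Context (R : realType) (H : completeNormedModType R).
Implicit Types (tau : R) (x y : H).

(** A branch-free form, which makes continuity visible. *)
Lemma clipE tau x : 0 < tau -> clip tau x = (tau / Num.max tau `|x|) *: x.
Proof.
move=> t0; rewrite /clip; have [xt|xt] := leP `|x| tau; last by [].
by rewrite divff ?scale1r// gt_eqF.
Qed.

Lemma clip_continuous tau : 0 < tau -> continuous (@clip R H tau).
Proof.
move=> t0; rewrite (_ : clip tau = fun x => (tau / Num.max tau `|x|) *: x).
  have m0 x : Num.max tau `|x| != 0 by rewrite gt_eqF// lt_max t0.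
  move=> x; apply: cvgZ; last exact: cvg_id.
  apply: cvgM; first exact: cvg_cst.
  apply: cvgV => //; apply: continuous_max; first exact: cvg_cst.
  exact: norm_continuous.
by apply/funext => x; rewrite clipE.
Qed.

Lemma norm_clip tau x : 0 < tau -> `|clip tau x| = Num.min `|x| tau.
Proof.
move=> t0; rewrite /clip; have [//|xt] := leP `|x| tau.
by rewrite normrZ normrM normfV normr_id divfK ?gtr0_norm// gt_eqF// (lt_trans t0).
Qed.

Lemma norm_clip_le tau x : 0 < tau -> `|clip tau x| <= tau.
Proof. by move=> t0; rewrite norm_clip// ge_min lexx orbT. Qed.

Lemma norm_clipB tau x : 0 < tau ->
  `|clip tau x - x| = Num.max (`|x| - tau) 0.
Proof.
move=> t0; rewrite /clip; have [xt|xt] := leP `|x| tau.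
  by rewrite subrr normr0 max_r// subr_le0.
have x0 : 0 < `|x| := lt_trans t0 xt.
rewrite max_l ?subr_ge0 ?(ltW xt)// -[X in _ - X]scale1r -scalerBl normrZ.
rewrite distrC ger0_norm; last by rewrite subr_ge0 ler_pdivrMr// mul1r ltW.
by rewrite mulrBl mul1r divfK ?gt_eqF.
Qed.

End clip.

(** * Strong measurability *)

Section strong_measurability.
Context (R : realType) (H : completeNormedModType R).
Context (d : measure_display) (T : measurableType d).
Implicit Types (s t f g : T -> H).

Lemma simple_vector_map2 s t (G : H -> H -> H) :
  simple_vector s -> simple_vector t -> simple_vector (fun w => G (s w) (t w)).
Proof.
move=> [fs ms] [ft mt]; split.
  apply: (@sub_finite_set _ _ [set G a b | a in range s & b in range t]).
    by move=> _ [w _ <-]; exists (s w); [exists w|exists (t w) => //; exists w].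
  exact: finite_image2.
move=> y; have -> : (fun w => G (s w) (t w)) @^-1` [set y] =
    \bigcup_(c in (range s `*` range t) `&` [set c | G c.1 c.2 = y])
      ((s @^-1` [set c.1]) `&` (t @^-1` [set c.2])).
  apply/seteqP; split => [w /= <-|w [[a b] [_ /= <-] [/= -> ->]]]; last by [].
  by exists (s w, t w); split => //=; split; exists w.
apply: fin_bigcup_measurable; first exact/finite_setIl/finite_setX.
by move=> c _; exact: measurableI.
Qed.

Lemma strongly_measurable_cst (c : H) : strongly_measurable (fun _ : T => c).
Proof.
exists (fun _ _ => c); split => [k|w]; last exact: cvg_cst.
split; first by apply: (sub_finite_set _ (finite_set1 c)) => _ [_ _ <-].
by move=> y; rewrite preimage_cst; case: ifP.
Qed.

Lemma strongly_measurable_comp f (G : H -> H) : continuous G ->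
  strongly_measurable f -> strongly_measurable (G \o f).
Proof.
move=> cG [s [ss sf]]; exists (fun k => G \o s k); split.
  by move=> k; exact: (simple_vector_map2 (fun x _ => G x) (ss k) (ss k)).
by move=> w; apply: continuous_cvg; [exact: cG|exact: sf].
Qed.

Lemma strongly_measurableD f g : strongly_measurable f ->
  strongly_measurable g -> strongly_measurable (fun w => f w + g w).
Proof.
move=> [s [ss sf]] [t [st tg]]; exists (fun k w => s k w + t k w); split.
  by move=> k; exact: (simple_vector_map2 (fun x y => x + y) (ss k) (st k)).
by move=> w; apply: cvgD; [exact: sf|exact: tg].
Qed.

Lemma strongly_measurableZ (c : R) f : strongly_measurable f ->
  strongly_measurable (fun w => c *: f w).
Proof.
by apply: (@strongly_measurable_comp f ( *:%R c)) => x; exact: scaler_continuous.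
Qed.

Lemma strongly_measurableB f g : strongly_measurable f ->
  strongly_measurable g -> strongly_measurable (fun w => f w - g w).
Proof.
move=> mf mg; apply: strongly_measurableD => //.
rewrite (_ : (fun w => - g w) = fun w => (-1) *: g w).
  exact: strongly_measurableZ.
by apply/funext => w; rewrite scaleN1r.
Qed.

Lemma strongly_measurable_sum (I : Type) (r : seq I) (F : I -> T -> H) :
  (forall i, strongly_measurable (F i)) ->
  strongly_measurable (fun w => \sum_(i <- r) F i w).
Proof.
move=> mF; elim: r => [|i r IH].
  under eq_fun do rewrite big_nil; exact: strongly_measurable_cst.
by under eq_fun do rewrite big_cons; exact: strongly_measurableD.
Qed.

Definition borelType := g_sigma_algebraType (@open H).

(** The values of the approximating simple functions, enumerated along pairs
    (index of the function, position among its values). *)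
Lemma strongly_measurable_dense f : strongly_measurable f ->
  exists h : nat -> H, forall w (e : R), 0 < e -> exists j, `|f w - h j| < e.
Proof.
move=> [s [ss sf]].
have /choice[l lE] : forall k, exists l : seq H, forall w, s k w \in l.
  move=> k; have [fs _] := ss k; have /finite_seqP[l lE] := fs.
  exists l => w; have : range (s k) (s k w) by exists w.
  by rewrite lE.
exists (fun n => if unpickle n is Some (k, j) then nth 0 (l k) j else 0).
move=> w e e0; have /cvgrPdist_lt /(_ e e0) [k _ /(_ k (leqnn k)) hk] := sf w.
exists (pickle (k, index (s k w) (l k))); rewrite pickleK.
by rewrite nth_index.
Qed.

Lemma continuous_measurable_borel (psi : H -> R) : continuous psi ->
  measurable_fun setT (psi : borelType -> R).
Proof.
move=> cpsi; apply: (measurability _ (@RGenOpens.measurableE R)).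
move=> _ [_ [a [b ->] <-]]; rewrite setTI; apply: sub_sigma_algebra.
by move/continuousP: cpsi; apply; exact: interval_open.
Qed.

Lemma strongly_measurable_norm f (z : H) : strongly_measurable f ->
  measurable_fun setT (fun w => `|f w - z|).
Proof.
move=> [s [ss sf]]; apply: (@measurable_fun_cvg _ _ _ _ (fun k w => `|s k w - z|)).
  move=> k; have [fs ms] := ss k; move=> _ B mB; rewrite setTI.
  have -> : (fun w => `|s k w - z|) @^-1` B =
      \bigcup_(a in range (s k) `&` [set a | B `|a - z|]) (s k @^-1` [set a]).
    apply/seteqP; split => [w /= Bw|w [a [_ /= Ba] /= ->]]; last by [].
    by exists (s k w) => //; split => //; exists w.
  by apply: fin_bigcup_measurable => //; exact: finite_setIl.
move=> w _; apply: cvg_norm; apply: cvgB; [exact: sf|exact: cvg_cst].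
Qed.

(** The preimage of an open set [U] is a countable union of preimages of balls
    contained in [U], centred in a sequence dense in the range. *)
Lemma strongly_measurable_borel f : strongly_measurable f ->
  measurable_fun setT (f : T -> borelType).
Proof.
move=> mf; have [h hf] := strongly_measurable_dense mf.
apply: (@measurability _ _ _ borelType setT f (@open H)) => // _ [U oU <-]; rewrite setTI.
have -> : f @^-1` U = \bigcup_j \bigcup_(m in [set m | ball (h j) m.+1%:R^-1 `<=` U])
    [set w | `|f w - h j| < m.+1%:R^-1].
  apply/seteqP; split => [w /= Uw|w [j _ [m /= hU wm]]]; last first.
    by apply: hU; rewrite -ball_normE /= distrC.
  have /nbhs_ballP[e /= e0 eU] : nbhs (f w) U by exact: open_nbhs_nbhs.
  have e20 : 0 < e / 2 by rewrite divr_gt0.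
  pose m := Num.truncn (e / 2)^-1.
  have me : m.+1%:R^-1 < e / 2.
    by rewrite invf_plt ?posrE// truncnS_gt.
  have [j hj] := hf w m.+1%:R^-1 ltac:(by rewrite invr_gt0).
  exists j => //; exists m => //= y; rewrite -ball_normE /= => hy.
  apply: eU; rewrite -ball_normE /=.
  rewrite -[f w](subrK (h j)) -addrA (le_lt_trans (ler_normD _ _))//.
  by rewrite [e]splitr ltrD// (lt_trans _ me).
apply: bigcup_measurable => j _; apply: bigcup_measurable => m _.
rewrite -[X in measurable X]setTI (_ : mkset _ = (fun w => `|f w - h j|) @^-1` `]-oo, m.+1%:R^-1[%classic).
  by apply: (strongly_measurable_norm (h j) mf) => //.
by apply/seteqP; split => w /=; rewrite in_itv.
Qed.

Lemma strongly_measurable_realfun f (psi : H -> R) : continuous psi ->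
  strongly_measurable f -> measurable_fun setT (psi \o f).
Proof.
move=> cpsi mf; exact: (measurableT_comp (continuous_measurable_borel cpsi)
  (strongly_measurable_borel mf)).
Qed.

End strong_measurability.

(** * Bochner means *)

Section real_sequences.
Context (R : realType).
Implicit Types u v : nat -> R.

(** Identifies an integral [c] with the limit of its approximations [u k]. *)
Lemma cvg_dist_eq u v (c l : R) : (forall k, `|c - u k| <= v k) ->
  v @ \oo --> 0 -> u @ \oo --> l -> c = l.
Proof.
move=> cu v0 ul; apply/eqP; rewrite -subr_eq0 -normr_le0.
apply: (@ler_cvg_to _ _ _ _ (fun k => `|c - u k|) v _ _ _ v0).
  by apply: cvg_norm; apply: cvgB ul; exact: cvg_cst.
by apply: nearW.
Qed.

Lemma cvgMr_to0 u (c : R) : u @ \oo --> 0 -> (fun k => c * u k) @ \oo --> 0.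
Proof. by move=> u0; rewrite -(mulr0 c); apply: cvgM => //; exact: cvg_cst. Qed.

End real_sequences.

Section real_expectation.
Context (R : realType) (d : measure_display) (T : measurableType d).
Context (P : probability T R).
Implicit Types f g : T -> R.

Local Notation integ f := (P.-integrable setT (EFin \o f)).

Lemma expectationRE f : integ f -> 'E_P[f]%E = (\int[P]_w f w)%:E.
Proof. by move=> fi; rewrite unlock /Rintegral fineK// integrable_fin_num. Qed.

Lemma integrable_dom f g : measurable_fun setT f -> (forall w, `|f w| <= g w) ->
  integ g -> integ f.
Proof.
move=> mf fg; apply: le_integrable => //; first exact/measurable_EFinP.
by move=> w _ /=; rewrite lee_fin (le_trans (fg w)) ?ler_norm.
Qed.

Lemma integrable_cstR (c : R) : integ (fun=> c).
Proof. exact: finite_measure_integrable_cst. Qed.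

Lemma integrable_bounded f (B : R) : measurable_fun setT f ->
  (forall w, `|f w| <= B) -> integ f.
Proof. by move=> mf fB; apply: integrable_dom mf fB _; exact: integrable_cstR. Qed.

Lemma integrable_addR f g : integ f -> integ g -> integ (fun w => f w + g w).
Proof. by move=> fi gi; exact: (integrableD measurableT fi gi). Qed.

Lemma integrable_subR f g : integ f -> integ g -> integ (fun w => f w - g w).
Proof. by move=> fi gi; exact: (integrableB measurableT fi gi). Qed.

Lemma integrable_scaleR (c : R) f : integ f -> integ (fun w => c * f w).
Proof. by move=> fi; exact: (integrableZl measurableT c fi). Qed.

Lemma integrable_sumR (I : Type) (r : seq I) (F : I -> T -> R) :
  (forall i, integ (F i)) -> integ (fun w => \sum_(i <- r) F i w).
Proof.
move=> Fi; elim: r => [|i r IH].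
  by under eq_fun do rewrite big_nil; exact: integrable_cstR.
by under eq_fun do rewrite big_cons; exact: integrable_addR.
Qed.

Lemma Rintegral_sum (I : Type) (r : seq I) (F : I -> T -> R) :
  (forall i, integ (F i)) ->
  \int[P]_w (\sum_(i <- r) F i w) = \sum_(i <- r) \int[P]_w F i w.
Proof.
move=> Fi; elim: r => [|i r IH].
  under eq_Rintegral do rewrite big_nil.
  by rewrite big_nil Rintegral_cst// mul0r.
under eq_Rintegral do rewrite big_cons.
by rewrite big_cons RintegralD ?IH//; exact: integrable_sumR.
Qed.

Lemma Rintegral_le f g : integ f -> integ g -> (forall w, f w <= g w) ->
  \int[P]_w f w <= \int[P]_w g w.
Proof. by move=> fi gi fg; exact: le_Rintegral. Qed.

Lemma Rintegral_cstP (c : R) : \int[P]_w c = c.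
Proof. by rewrite Rintegral_cst// [X in _ * X](congr1 fine (probability_setT P)) mulr1. Qed.

Lemma Rintegral_indic (A : set T) : measurable A ->
  \int[P]_w (\1_A w) = fine (P A).
Proof. by move=> mA; rewrite /Rintegral integral_indic// setIT. Qed.

Lemma integrable_indicR (A : set T) : measurable A -> integ (\1_A : T -> R).
Proof. by move=> mA; exact: integrable_indic. Qed.

Lemma Rintegral_cvg0 (f : nat -> T -> R) (B : R) :
  (forall k, measurable_fun setT (f k)) -> (forall k w, `|f k w| <= B) ->
  (forall w, (fun k => f k w) @ \oo --> 0) ->
  (fun k => \int[P]_w f k w) @ \oo --> 0.
Proof.
move=> mf fB f0; apply: fine_cvg.
have := @dominated_cvg _ _ _ P setT measurableT (fun k w => (f k w)%:E)
  (fun=> 0%E) (fun=> B%:E) (fun k => iffRL (measurable_EFinP _ _) (mf k)).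
rewrite integral0; apply => //.
- by move=> w _; apply: cvg_EFin; [exact: nearW|exact: f0].
- exact: integrable_cstR.
- by move=> k w _; rewrite /= lee_fin.
Qed.

End real_expectation.

Section bochner.
Context (R : realType) (H : completeNormedModType R).
Variables (ip : {dot H for (@idfun R)}).
Hypothesis ip_norm : forall x : H, ip x x = `|x| ^+ 2.
Context (d : measure_display) (T : measurableType d) (P : probability T R).
Implicit Types (f g s : T -> H) (m : H).

Local Notation integ f := (P.-integrable setT (EFin \o f)).
Local Notation integv f := (P.-integrable setT (EFin \o (fun w => `|f w|))).

Lemma measurable_norm f : strongly_measurable f ->
  measurable_fun setT (fun w => `|f w|).
Proof. by move=> mf; exact: (strongly_measurable_realfun (@norm_continuous _ _) mf). Qed.

Lemma measurable_ip f z : strongly_measurable f ->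
  measurable_fun setT (fun w => ip (f w) z : R).
Proof.
by move=> mf; exact: (strongly_measurable_realfun (@ip_continuous _ _ _ ip_norm z) mf).
Qed.

(** By polarization: unless [H] is separable, Borel sets of [H * H] need not be
    generated by products of Borel sets, so [ip] is composed with one function
    at a time. *)
Lemma measurable_ip2 f g : strongly_measurable f -> strongly_measurable g ->
  measurable_fun setT (fun w => ip (f w) (g w) : R).
Proof.
move=> mf mg; rewrite (_ : (fun w => _) = fun w =>
    2^-1 * (`|f w| ^+ 2 + `|g w| ^+ 2 - `|f w - g w| ^+ 2)); last first.
  by apply/funext => w; rewrite (sqr_normB ip_norm); field.
apply: measurable_funM; first exact: measurable_cst.
apply: measurable_funB; first apply: measurable_funD.
- by apply: measurable_funX; exact: measurable_norm.
- by apply: measurable_funX; exact: measurable_norm.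
- by apply: measurable_funX; apply: measurable_norm; exact: strongly_measurableB.
Qed.

Lemma integrable_ip f z : strongly_measurable f -> integv f ->
  integ (fun w => ip (f w) z).
Proof.
move=> mf fi; apply: integrable_dom (integrable_scaleR `|z| fi).
  exact: measurable_ip.
by move=> w; rewrite mulrC; exact: ip_le.
Qed.

Lemma norm_Rintegral_ip f z : strongly_measurable f -> integv f ->
  `|\int[P]_w ip (f w) z| <= `|z| * \int[P]_w `|f w|.
Proof.
move=> mf fi; rewrite -RintegralZl//.
have ifz := integrable_ip z mf fi.
apply: le_trans (le_normr_Rintegral measurableT ifz) _.
apply: Rintegral_le; first exact: (integrable_abse ifz).
- exact: integrable_scaleR.
- by move=> w; rewrite mulrC; exact: ip_le.
Qed.

(** The Pettis mean. A Bochner mean is one, and a Pettis mean is unique, so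
    once existence of the Bochner mean is known every computation with it
    reduces to real integrals. *)
Definition weak_mean f m := forall z, \int[P]_w ip (f w) z = ip m z.

(** Test the mean against itself. *)
Lemma norm_weak_mean f m : strongly_measurable f -> integv f ->
  weak_mean f m -> `|m| <= \int[P]_w `|f w|.
Proof.
move=> mf fi fm; have := norm_Rintegral_ip m mf fi.
rewrite fm ip_norm ger0_norm ?exprn_ge0// expr2.
have [->|m0] := eqVneq `|m| 0; first by move=> _; exact: Rintegral_ge0.
by rewrite ler_pM2l// lt0r m0 /=.
Qed.

Lemma simple_strongly_measurable s : simple_vector s -> strongly_measurable s.
Proof. by move=> ss; exists (fun=> s); split => // w; exact: cvg_cst. Qed.

Lemma simple_bounded s : simple_vector s -> exists B : R, forall w, `|s w| <= B.
Proof.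
move=> [/finite_seqP[l lE] _]; exists (\sum_(y <- l) `|y|) => w.
have : s w \in l by have : range s (s w) by [exists w]; rewrite lE.
move=> /[dup] sl /(perm_to_rem) pl.
by rewrite (perm_big _ pl) big_cons lerDl sumr_ge0.
Qed.

Lemma bounded_integrable f (B : R) : strongly_measurable f ->
  (forall w, `|f w| <= B) -> integv f.
Proof.
move=> mf fB; apply: (@integrable_bounded _ _ _ _ _ B); first exact: measurable_norm.
by move=> w; rewrite normr_id.
Qed.

Lemma simple_integrable s : simple_vector s -> integv s.
Proof.
move=> ss; have [B sB] := simple_bounded ss.
by apply: bounded_integrable sB; exact: simple_strongly_measurable.
Qed.

Lemma simple_vectorE s w : simple_vector s ->
  s w = \sum_(y <- fset_set (range s)) \1_(s @^-1` [set y]) w *: y.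
Proof.
move=> [fs _]; rewrite (big_fsetD1 (s w)) /=; last first.
  by rewrite in_fset_set//; apply/mem_set; exists w.
rewrite indicE mem_set//= scale1r big1_seq ?addr0// => y /=.
rewrite !inE => /andP[ys _]; rewrite indicE memNset ?scale0r//= => e.
by rewrite e eqxx in ys.
Qed.

Lemma simple_meanE s : simple_vector s -> simple_mean P s =
  \sum_(y <- fset_set (range s)) fine (P (s @^-1` [set y])) *: y.
Proof. by move=> [fs _]; rewrite /simple_mean fsbig_finite. Qed.

Lemma simple_mean_weak s : simple_vector s -> weak_mean s (simple_mean P s).
Proof.
move=> ss z; rewrite simple_meanE// ip_suml.
under eq_Rintegral do rewrite (simple_vectorE _ ss) ip_suml.
have mA y : measurable (s @^-1` [set y]) by apply: ss.2.
have iA y : integ (fun w => ip (\1_(s @^-1` [set y]) w *: y) z).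
  under [X in EFin \o X]eq_fun do rewrite ipZl mulrC.
  by apply: integrable_scaleR; exact: integrable_indicR.
rewrite Rintegral_sum//; apply: eq_bigr => y _.
under eq_Rintegral do rewrite ipZl mulrC.
rewrite RintegralZl//; last exact: integrable_indicR.
by rewrite Rintegral_indic// ipZl mulrC.
Qed.

Lemma weak_meanB f g m m' : strongly_measurable f -> strongly_measurable g ->
  integv f -> integv g -> weak_mean f m -> weak_mean g m' ->
  weak_mean (fun w => f w - g w) (m - m').
Proof.
move=> mf mg fi gi fm gm z; under eq_Rintegral do rewrite ipBl.
by rewrite RintegralB ?fm ?gm ?ipBl//; exact: integrable_ip.
Qed.

Lemma integrable_normD f g : strongly_measurable f -> strongly_measurable g ->
  integv f -> integv g -> integv (fun w => f w + g w).
Proof.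
move=> mf mg fi gi; apply: integrable_dom (integrable_addR fi gi).
  by apply: measurable_norm; exact: strongly_measurableD.
by move=> w; rewrite normr_id ler_normD.
Qed.

Lemma integrable_normB f g : strongly_measurable f -> strongly_measurable g ->
  integv f -> integv g -> integv (fun w => f w - g w).
Proof.
move=> mf mg fi gi; apply: integrable_dom (integrable_addR fi gi).
  by apply: measurable_norm; exact: strongly_measurableB.
by move=> w; rewrite normr_id ler_normB.
Qed.

Lemma expectation_norm_approx f (s : nat -> T -> H) :
  strongly_measurable f -> (forall k, simple_vector (s k)) ->
  (fun k => 'E_P[fun w => `|f w - s k w|%R]%E) @ \oo --> 0%E ->
  integv f /\ (fun k => \int[P]_w `|f w - s k w|) @ \oo --> 0.
Proof.
move=> mf ss /fine_cvgP[fin cv].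
have ms k : strongly_measurable (s k) by exact: simple_strongly_measurable.
have mB k : strongly_measurable (fun w => f w - s k w) by exact: strongly_measurableB.
have fi : integv f.
  have [k _ /(_ k (leqnn k)) hk] := fin.
  have fsi : integv (fun w => f w - s k w).
    apply/integrableP; split; first by apply/measurable_EFinP; exact: measurable_norm.
    under eq_integral do rewrite gee0_abs ?lee_fin//.
    by move: hk; rewrite unlock ge0_fin_numE ?integral_ge0// => w _; rewrite lee_fin.
  have := integrable_normD (mB k) (ms k) fsi (simple_integrable (ss k)).
  by under eq_fun do rewrite subrK.
split => //; apply: cvg_trans cv; apply: near_eq_cvg; apply: nearW => k /=.
rewrite expectationRE//; apply: integrable_normB => //; exact: simple_integrable.
Qed.

Lemma has_mean_integrable f m : has_mean P f m -> integv f.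
Proof. by case=> mf [s [ss cs _]]; have [] := expectation_norm_approx mf ss cs. Qed.

(** Both sides are continuous along the approximating simple functions: the
    left one in mean, the right one by continuity of the inner product. *)
Lemma has_mean_weak f m : has_mean P f m -> weak_mean f m.
Proof.
case=> mf [s [ss cs sm]] z; have [fi cv] := expectation_norm_approx mf ss cs.
have ms k : strongly_measurable (s k) by exact: simple_strongly_measurable.
have csm : (fun k => ip (simple_mean P (s k)) z) @ \oo --> ip m z.
  exact: (@continuous_cvg _ _ _ _ _ _ (fun x => ip x z) _ (@ip_continuous _ _ _ ip_norm z m) sm).
apply: (cvg_dist_eq _ (cvgMr_to0 `|z| cv) csm) => k.
have si := simple_integrable (ss k).
rewrite -(simple_mean_weak (ss k)) -RintegralB//; [|exact: integrable_ip..].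
under eq_Rintegral do rewrite -ipBl.
by apply: norm_Rintegral_ip; [exact: strongly_measurableB|exact: integrable_normB].
Qed.

(** Clipping the simple functions that approximate [f] at a level above a bound
    of [f] keeps them simple and convergent, and makes dominated convergence
    available; the simple means are then Cauchy by [norm_weak_mean]. *)
Lemma bounded_has_mean f (B : R) : strongly_measurable f ->
  (forall w, `|f w| <= B) -> exists m, has_mean P f m.
Proof.
move=> mf fB; pose C := `|B| + 1.
have C0 : 0 < C by rewrite ltr_wpDl.
have BC w : `|f w| <= C.
  by rewrite (le_trans (fB w))// (le_trans (ler_norm B))// lerDl.
have [s0 [ss0 sf0]] := mf; pose s k := clip C \o s0 k.
have ss k : simple_vector (s k).
  exact: (simple_vector_map2 (fun x _ => clip C x) (ss0 k) (ss0 k)).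
have ms k : strongly_measurable (s k) by exact: simple_strongly_measurable.
have sC k w : `|s k w| <= C by exact: norm_clip_le.
have sf w : (fun k => s k w) @ \oo --> f w.
  have -> : f w = clip C (f w) by rewrite /clip BC.
  by apply: continuous_cvg; [exact: clip_continuous|exact: sf0].
have fi : integv f by exact: bounded_integrable BC.
have si k : integv (s k) by exact: simple_integrable.
have cv : (fun k => \int[P]_w `|f w - s k w|) @ \oo --> 0.
  apply: (@Rintegral_cvg0 _ _ _ _ _ (C + C)).
  - by move=> k; apply: measurable_norm; exact: strongly_measurableB.
  - by move=> k w; rewrite normr_id (le_trans (ler_normB _ _))// lerD.
  - by move=> w; rewrite -(normr0 H) -(subrr (f w)); apply: cvg_norm; apply: cvgB => //; exact: cvg_cst.
have /cauchy_cvgP/cvg_ex[m mm] : cauchy ((fun k => simple_mean P (s k)) @ \oo).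
  apply/cauchy_ballP => e e0; near_simpl.
  have e20 : 0 < e / 2 by rewrite divr_gt0.
  have /cvgr0_norm_lt /(_ _ e20) [N _ hN] := cv.
  exists ([set k | (N <= k)%N], [set k | (N <= k)%N]).
    by split; exists N.
  move=> [k l] [/= Nk Nl]; rewrite -ball_normE /=.
  have := norm_weak_mean (strongly_measurableB (ms k) (ms l))
    (integrable_normB (ms k) (ms l) (si k) (si l))
    (weak_meanB (ms k) (ms l) (si k) (si l)
      (simple_mean_weak (ss k)) (simple_mean_weak (ss l))).
  move=> /le_lt_trans; apply.
  have ik k' : integv (fun w => f w - s k' w) by exact: integrable_normB.
  apply: (@le_lt_trans _ _ (\int[P]_w (`|f w - s k w| + `|f w - s l w|))).
    apply: Rintegral_le; [exact: integrable_normB|exact: integrable_addR|].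
    move=> w; have := ler_normD (s k w - f w) (f w - s l w).
    by rewrite addrA subrK (distrC (s k w) (f w)).
  rewrite RintegralD// [e]splitr ltrD//.
    by rewrite (le_lt_trans (ler_norm _))// hN.
  by rewrite (le_lt_trans (ler_norm _))// hN.
exists m; split => //; exists s; split => //.
rewrite (_ : (fun k => _) = fun k => (\int[P]_w `|f w - s k w|)%:E).
  by apply: cvg_EFin => //; exact: nearW.
apply/funext => k; rewrite expectationRE//; exact: integrable_normB.
Qed.

Lemma bochner_meanP f (B : R) : strongly_measurable f ->
  (forall w, `|f w| <= B) -> has_mean P f (bochner_mean P f).
Proof.
move=> mf fB; have [m fm] := bounded_has_mean mf fB.
exact: (@xgetPex _ 0 [set m | has_mean P f m] (ex_intro _ m fm)).
Qed.

End bochner.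

(** * Equality of laws and independence *)

Section laws.
Context (R : realType) (H : completeNormedModType R).
Context (d : measure_display) (T : measurableType d) (P : probability T R).

(** Image measures under [f] and [g] agree on Borel sets; the positive and
    negative parts of [psi] are transferred separately, so infinite integrals
    are covered as well. *)
Lemma integral_same_law (f g : T -> H) (psi : borelType H -> \bar R) :
  strongly_measurable f -> strongly_measurable g ->
  (forall B : set H, borel_set B -> P (f @^-1` B) = P (g @^-1` B)) ->
  measurable_fun setT psi ->
  (\int[P]_w psi (f w) = \int[P]_w psi (g w))%E.
Proof.
move=> /strongly_measurable_borel mf /strongly_measurable_borel mg fg mpsi.
have ge0 (phi : borelType H -> \bar R) : measurable_fun setT phi ->
    (forall y, 0 <= phi y)%E ->
    (\int[P]_w phi (f w) = \int[P]_w phi (g w))%E.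
  move=> mphi phi0.
  transitivity (\int[pushforward P (f : T -> borelType H)]_y phi y)%E.
    by rewrite (ge0_integral_pushforward mf).
  transitivity (\int[pushforward P (g : T -> borelType H)]_y phi y)%E.
    by apply: eq_measure_integral => B mB _; exact: fg.
  by rewrite (ge0_integral_pushforward mg).
rewrite [LHS]integralE [RHS]integralE.
rewrite (funepos_comp psi f) (funepos_comp psi g).
rewrite (funeneg_comp psi f) (funeneg_comp psi g); congr (_ - _)%E.
  by apply: ge0 => //; exact: measurable_funepos.
by apply: ge0 => //; exact: measurable_funeneg.
Qed.

Lemma integral_continuous_same_law (f g : T -> H) (psi : H -> R) :
  strongly_measurable f -> strongly_measurable g ->
  (forall B : set H, borel_set B -> P (f @^-1` B) = P (g @^-1` B)) ->
  continuous psi ->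
  (\int[P]_w (psi (f w))%:E = \int[P]_w (psi (g w))%:E)%E.
Proof.
move=> mf mg fg cpsi; apply: (integral_same_law (psi := EFin \o psi)) => //.
by apply/measurable_EFinP; exact: continuous_measurable_borel.
Qed.

End laws.

Section nearest_point.
Context (R : realType) (H : completeNormedModType R) (h : nat -> H).

(** [nearest k] sends a point to a closest one among [h 0], ..., [h k]. Defining
    the distance first keeps the index measurable by induction on [k]. *)
Fixpoint nearest_dist (k : nat) (y : H) : R :=
  if k is k'.+1 then Num.min `|y - h k| (nearest_dist k' y) else `|y - h 0|.

Fixpoint nearest_index (k : nat) (y : H) : nat :=
  if k is k'.+1 then
    if `|y - h k| < nearest_dist k' y then k else nearest_index k' y
  else 0.

Definition nearest k y := h (nearest_index k y).

Lemma nearest_distE k y : `|y - nearest k y| = nearest_dist k y.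
Proof.
by elim: k => //= k IH; rewrite /nearest /=; case: ltP => // _.
Qed.

Lemma nearest_dist_le k j y : (j <= k)%N -> nearest_dist k y <= `|y - h j|.
Proof.
elim: k => [|k IH] /=; first by rewrite leqn0 => /eqP ->.
by rewrite leq_eqVlt => /predU1P[->|/IH jk]; rewrite ge_min ?lexx// jk orbT.
Qed.

Lemma nearest_index_le k y : (nearest_index k y <= k)%N.
Proof. by elim: k => //= k IH; case: ifP => // _; exact: leqW. Qed.

Lemma measurable_norm_sub (z : H) :
  measurable_fun setT ((fun y => `|y - z|) : borelType H -> R).
Proof.
apply: continuous_measurable_borel => y; apply: cvg_norm; apply: cvgB.
  exact: cvg_id.
exact: cvg_cst.
Qed.

Lemma measurable_nearest_dist k :
  measurable_fun setT (nearest_dist k : borelType H -> R).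
Proof.
elim: k => [|k IH] /=; first exact: measurable_norm_sub.
by apply: measurable_minr => //; exact: measurable_norm_sub.
Qed.

Lemma measurable_nearest_index k :
  measurable_fun setT (nearest_index k : borelType H -> nat).
Proof.
elim: k => [|k IH] /=; first exact: measurable_cst.
apply: measurable_fun_ifT => //; apply: measurable_fun_ltr.
  exact: measurable_norm_sub.
exact: measurable_nearest_dist.
Qed.

Lemma borel_nearest k (z : H) : borel_set (nearest k @^-1` [set z]).
Proof.
have := @measurable_nearest_index k measurableT (h @^-1` [set z]).
by rewrite setTI; apply.
Qed.

Lemma simple_nearest (d : measure_display) (T : measurableType d) (f : T -> H) k :
  strongly_measurable f -> simple_vector (nearest k \o f).
Proof.
move=> mf; split.
  apply: (@sub_finite_set _ _ (h @` `I_k.+1)); last exact: finite_image.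
  by move=> _ [w _ <-]; exists (nearest_index k (f w)) => //=; rewrite ltnS nearest_index_le.
move=> z; have := strongly_measurable_borel mf measurableT (borel_nearest k z).
by rewrite setTI.
Qed.

End nearest_point.

Section independence.
Context (R : realType) (H : completeNormedModType R).
Variables (ip : {dot H for (@idfun R)}).
Hypothesis ip_norm : forall x : H, ip x x = `|x| ^+ 2.
Context (d : measure_display) (T : measurableType d) (P : probability T R).
Implicit Types (f g s t : T -> H) (m : H).

Definition independent_pair f g := forall A B : set H,
  borel_set A -> borel_set B ->
  P ((f @^-1` A) `&` (g @^-1` B)) = (P (f @^-1` A) * P (g @^-1` B))%E.

Lemma simple_ip_independent s t : simple_vector s -> simple_vector t ->
  (forall y z, P ((s @^-1` [set y]) `&` (t @^-1` [set z])) =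
    (P (s @^-1` [set y]) * P (t @^-1` [set z]))%E) ->
  \int[P]_w ip (s w) (t w) = ip (simple_mean P s) (simple_mean P t).
Proof.
move=> ss st ind.
have ms y : measurable (s @^-1` [set y]) by apply: ss.2.
have mt y : measurable (t @^-1` [set y]) by apply: st.2.
pose F y z w := ip y z * \1_((s @^-1` [set y]) `&` (t @^-1` [set z])) w : R.
have iF y z : P.-integrable setT (EFin \o F y z).
  by apply: integrable_scaleR; apply: integrable_indicR; exact: measurableI.
transitivity (\int[P]_w \sum_(y <- fset_set (range s))
    \sum_(z <- fset_set (range t)) F y z w).
  apply: eq_Rintegral => w _.
  rewrite [s w](simple_vectorE _ ss) [t w](simple_vectorE _ st) ip_suml.
  apply: eq_bigr => y _; rewrite ip_sumr; apply: eq_bigr => z _.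
  by rewrite ipZl ipZr /F indicI mulrA [RHS]mulrC.
rewrite Rintegral_sum; last by move=> y; apply: integrable_sumR.
rewrite (simple_meanE _ ss) (simple_meanE _ st) ip_suml.
apply: eq_bigr => y _; rewrite Rintegral_sum// ip_sumr; apply: eq_bigr => z _.
rewrite /F RintegralZl//; last by apply: integrable_indicR; exact: measurableI.
rewrite Rintegral_indic; last exact: measurableI.
rewrite ind fineM ?fin_num_measure// ipZl ipZr mulrA [RHS]mulrC.
by [].
Qed.

(** The approximating simple functions are Borel functions of [f] itself. The
    ones that witness strong measurability need not be, and would not inherit
    independence from [f]. *)
Lemma nearest_approx f (B : R) : strongly_measurable f -> (forall w, `|f w| <= B) ->
  exists s : nat -> T -> H, exists C : R,
  [/\ forall k, simple_vector (s k),
      forall k, exists2 phi : H -> H, s k = phi \o f &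
        forall z, borel_set (phi @^-1` [set z]),
      forall k w, `|s k w| <= C
    & (fun k => \int[P]_w `|f w - s k w|) @ \oo --> 0].
Proof.
move=> mf fB; have [h hf] := strongly_measurable_dense mf.
have dB k w : `|f w - nearest h k (f w)| <= B + `|h 0%N|.
  rewrite nearest_distE (le_trans (nearest_dist_le _ _ (leq0n k)))//.
  by rewrite (le_trans (ler_normB _ _))// lerD2r.
exists (fun k => nearest h k \o f), (B + (B + `|h 0%N|)); split.
- by move=> k; exact: simple_nearest.
- by move=> k; exists (nearest h k) => //; exact: borel_nearest.
- move=> k w /=; rewrite -[nearest _ _ _](subKr (f w)).
  by rewrite (le_trans (ler_normB _ _))// lerD.
- apply: (@Rintegral_cvg0 _ _ _ _ _ (B + `|h 0%N|)).
  + move=> k; apply: measurable_norm; apply: strongly_measurableB => //.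
    by apply: simple_strongly_measurable; exact: simple_nearest.
  + by move=> k w; rewrite normr_id; exact: dB.
  + move=> w; apply/cvgrPdist_lt => e e0; have [j hj] := hf w e e0.
    exists j => // k /= jk; rewrite sub0r normrN normr_id nearest_distE.
    exact: le_lt_trans (nearest_dist_le _ _ jk) hj.
Qed.

(** For simple functions this is a finite double sum; the general case follows
    by discretising the values of [f] and [g], which preserves independence,
    and passing to the limit in mean. *)
Lemma ip_independent f g m m' (B : R) :
  strongly_measurable f -> strongly_measurable g ->
  (forall w, `|f w| <= B) -> (forall w, `|g w| <= B) ->
  weak_mean ip P f m -> weak_mean ip P g m' -> independent_pair f g ->
  \int[P]_w ip (f w) (g w) = ip m m'.
Proof.
move=> mf mg fB gB fm gm ind.
have [s [C [ss sphi sC scv]]] := nearest_approx mf fB.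
have [t [D [st tphi tD tcv]]] := nearest_approx mg gB.
have ms k : strongly_measurable (s k) by exact: simple_strongly_measurable.
have mt k : strongly_measurable (t k) by exact: simple_strongly_measurable.
have fi := bounded_integrable P mf fB.
have gi := bounded_integrable P mg gB.
have si k := simple_integrable P (ss k).
have ti k := simple_integrable P (st k).
have fsi k := integrable_normB mf (ms k) fi (si k).
have gti k := integrable_normB mg (mt k) gi (ti k).
have mfs k := strongly_measurableB mf (ms k).
have mgt k := strongly_measurableB mg (mt k).
have ipi (u v : T -> H) (b c : R) : strongly_measurable u ->
    strongly_measurable v -> (forall w, `|u w| <= b) -> (forall w, `|v w| <= c) ->
    P.-integrable setT (EFin \o (fun w => ip (u w) (v w))).
  move=> mu mv ub vc; apply: (@integrable_bounded _ _ _ _ _ (b * c)).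
    exact: measurable_ip2.
  by move=> w; rewrite (le_trans (ip_le ip_norm _ _))// ler_pM.
pose e k := \int[P]_w `|f w - s k w|; pose e' k := \int[P]_w `|g w - t k w|.
have st_ip k : \int[P]_w ip (s k w) (t k w) = ip (simple_mean P (s k)) (simple_mean P (t k)).
  apply: simple_ip_independent => // y z.
  have [phi -> bphi] := sphi k; have [phi' -> bphi'] := tphi k.
  exact: (ind _ _ (bphi y) (bphi' z)).
have mv k : `|m - simple_mean P (s k)| <= e k.
  apply: (norm_weak_mean ip_norm (mfs k)) => //.
  by apply: weak_meanB => //; exact: simple_mean_weak.
have mv' k : `|m' - simple_mean P (t k)| <= e' k.
  apply: (norm_weak_mean ip_norm (mgt k)) => //.
  by apply: weak_meanB => //; exact: simple_mean_weak.
have v'D k : `|simple_mean P (t k)| <= D.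
  apply: le_trans (norm_weak_mean ip_norm (mt k) (ti k) (simple_mean_weak _ _ (st k))) _.
  rewrite -(Rintegral_cstP P D); exact: Rintegral_le (ti k) (integrable_cstR _ _) (tD k).
have fgst k : `|\int[P]_w ip (f w) (g w) - \int[P]_w ip (s k w) (t k w)|
    <= B * e k + C * e' k.
  rewrite -RintegralB//; [|exact: ipi fB gB|exact: ipi (sC k) (tD k)].
  have ii := integrable_subR (ipi _ _ _ _ mf mg fB gB) (ipi _ _ _ _ (ms k) (mt k) (sC k) (tD k)).
  apply: le_trans (le_normr_Rintegral measurableT ii) _.
  rewrite -!RintegralZl// -RintegralD//; [|exact: integrable_scaleR..].
  apply: Rintegral_le; first exact: (integrable_abse ii).
    by apply: integrable_addR; exact: integrable_scaleR.
  move=> w; rewrite (_ : _ - _ = ip (g w) (f w - s k w) + ip (s k w) (g w - t k w)).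
    rewrite (le_trans (ler_normD _ _))// lerD// (le_trans (ip_le ip_norm _ _))//.
      by rewrite ler_wpM2r.
    by rewrite ler_wpM2r.
  by rewrite !ipBr (ipC _ (g w)) (ipC _ (g w)); ring.
apply: (@cvg_dist_eq _ (fun=> ip m m')
  (fun k => (B + D) * e k + (C + `|m|) * e' k)) => [k||].
- rewrite -(subrK (\int[P]_w ip (s k w) (t k w)) (\int[P]_w _)) -addrA.
  rewrite (le_trans (ler_normD _ _))//.
  rewrite (_ : _ + _ = (B * e k + C * e' k) + (D * e k + `|m| * e' k)); last by ring.
  rewrite lerD// st_ip distrC.
  rewrite (_ : _ - _ = ip (simple_mean P (t k)) (m - simple_mean P (s k)) +
     ip m (m' - simple_mean P (t k))).
    rewrite (le_trans (ler_normD _ _))// lerD// (le_trans (ip_le ip_norm _ _))//.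
      by rewrite ler_pM.
    by rewrite ler_wpM2l.
  by rewrite !ipBr (ipC _ (simple_mean P (t k))) (ipC _ (simple_mean P (t k))); ring.
- by rewrite -[X in _ --> X]addr0; apply: cvgD; apply: cvgMr_to0.
- exact: cvg_cst.
Qed.

End independence.

(** * The risk of a clipped mean *)

Section clipped_risk.
Context (R : realType) (H : completeNormedModType R).
Variables (ip : {dot H for (@idfun R)}).
Hypothesis ip_norm : forall x : H, ip x x = `|x| ^+ 2.
Context (d : measure_display) (T : measurableType d) (P : probability T R).

Lemma borel_preimage (g : H -> H) (A : set H) : continuous g ->
  borel_set A -> borel_set (g @^-1` A).
Proof.
move=> cg bA; rewrite -[_ @^-1` _]setTI.
have mg : measurable_fun setT (g : borelType H -> borelType H).
  apply: (@measurability _ _ (borelType H) (borelType H) setT g (@open H)) => // _ [U oU <-].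
  by rewrite setTI; apply: sub_sigma_algebra; move/continuousP: cg; apply.
exact: mg measurableT _ bA.
Qed.

Lemma continuous_ip_comp (g : H -> H) z : continuous g ->
  continuous (fun x => ip (g x) z).
Proof.
move=> cg x; exact: (@continuous_comp _ _ _ g (fun y => ip y z) x (cg x)
  (@ip_continuous _ _ _ ip_norm z (g x))).
Qed.

Lemma continuous_sqr_norm (g : H -> H) : continuous g ->
  continuous (fun x => `|g x| ^+ 2).
Proof.
move=> cg x; apply: (@continuous_comp _ _ _ (fun x => `|g x|) (fun r : R => r ^+ 2)).
  by apply: cvg_norm; exact: cg.
exact: exprn_continuous.
Qed.

Lemma mutually_independent_pair (n : nat) (X : 'I_n -> T -> H) (g : H -> H) i j :
  continuous g -> mutually_independent P X -> i != j ->
  independent_pair P (g \o X i) (g \o X j).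
Proof.
move=> cg ind ij A B bA bB.
have := ind [set i; j]%SET (fun k => if k == i then g @^-1` A else g @^-1` B).
rewrite big_setU1 ?inE//= big_set1 eqxx eq_sym (negbTE ij).
move=> <- => [|k]; last by case: ifP => _; exact: borel_preimage.
congr (P _); apply/seteqP; split => w /=.
  by move=> [Aw Bw] k; rewrite /= !inE => /orP[/eqP ->|/eqP ->]; rewrite ?eqxx// eq_sym (negbTE ij).
move=> h; split; first by have := h i; rewrite /= !inE eqxx => /(_ isT).
by have := h j; rewrite /= !inE eqxx orbT eq_sym (negbTE ij) => /(_ isT).
Qed.

(** Centred independent terms are orthogonal, so only the diagonal of the double
    sum survives, and its [n] entries are equal. *)
Lemma iid_average_variance (n : nat) (i0 : 'I_n) (X : 'I_n -> T -> H)
    (g : H -> H) (B : R) :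
  iid_vectors P X -> continuous g -> (forall x, `|g x| <= B) ->
  weak_mean ip P (g \o X i0) 0 ->
  \int[P]_w (`|n%:R^-1 *: \sum_(i < n) g (X i w)| ^+ 2) =
  n%:R^-1 * \int[P]_w (`|g (X i0 w)| ^+ 2).
Proof.
move=> [mX ind idX] cg gB g0.
have mg i : strongly_measurable (g \o X i) by exact: strongly_measurable_comp.
have gi i : weak_mean ip P (g \o X i) 0.
  move=> z; rewrite -g0; congr fine.
  apply: (integral_continuous_same_law (psi := fun x => ip (g x) z)) => //.
    by move=> A; exact: idX.
  exact: continuous_ip_comp.
have n0 : n%:R != 0 :> R by rewrite pnatr_eq0 -lt0n (leq_ltn_trans _ (ltn_ord i0)).
have ipi i j : P.-integrable setT (EFin \o (fun w => ip (g (X i w)) (g (X j w)))).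
  apply: (@integrable_bounded _ _ _ _ _ (B * B)).
    exact: (measurable_ip2 ip_norm (mg i) (mg j)).
  by move=> w; rewrite (le_trans (ip_le ip_norm _ _))// ler_pM.
transitivity (\int[P]_w (n%:R^-1 * n%:R^-1 *
    \sum_(i < n) \sum_(j < n) ip (g (X i w)) (g (X j w)))).
  apply: eq_Rintegral => w _; rewrite -ip_norm ipZl ipZr mulrA; congr (_ * _).
  by rewrite ip_suml; apply: eq_bigr => i _; rewrite ip_sumr.
have si i : P.-integrable setT (EFin \o (fun w => \sum_(j < n) ip (g (X i w)) (g (X j w)))).
  exact: integrable_sumR.
rewrite RintegralZl//; last exact: integrable_sumR.
rewrite Rintegral_sum// -mulrA; congr (_ * _).
rewrite (eq_bigr (fun=> \int[P]_w (`|g (X i0 w)| ^+ 2))).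
  by rewrite sumr_const card_ord -[X in _ * X]mulr_natl mulKf.
move=> i _; rewrite Rintegral_sum// (bigD1 i)//= big1 ?addr0; last first.
  move=> j ji; rewrite eq_sym in ji.
  have -> := ip_independent ip_norm (mg i) (mg j) (fun w => gB _) (fun w => gB _)
    (gi i) (gi j) (mutually_independent_pair cg ind ji).
  exact: ip0l.
transitivity (\int[P]_w (`|g (X i w)| ^+ 2)).
  by apply: eq_Rintegral => w _; rewrite ip_norm.
congr fine; apply: (integral_continuous_same_law (psi := fun x => `|g x| ^+ 2)) => //.
  by move=> A; exact: idX.
exact: continuous_sqr_norm.
Qed.

Section risk.
Variables (n : nat) (i0 : 'I_n) (X : 'I_n -> T -> H) (a : H) (tau : R).
Hypothesis iidX : iid_vectors P X.
Hypothesis tau0 : 0 < tau.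

Let Y i w := clip tau (X i w - a).

Lemma clip_shift_continuous : continuous (fun x : H => clip tau (x - a)).
Proof.
move=> x; apply: (@continuous_comp _ _ _ (fun x => x - a) (clip tau)).
  by apply: cvgB; [exact: cvg_id|exact: cvg_cst].
exact: clip_continuous.
Qed.

Lemma strongly_measurable_clip_shift i : strongly_measurable (Y i).
Proof.
case: iidX => mX _ _.
exact: (strongly_measurable_comp clip_shift_continuous (mX i)).
Qed.

Let YB i w : `|Y i w| <= tau. Proof. exact: norm_clip_le. Qed.

(** Apart from [mu], the risk depends only on the mean [m] and the second moment
    of one clipped increment; both bounds start from this identity. *)
Lemma weighted_riskE (mu m : H) (alpha beta : R) :
  weak_mean ip P (Y i0) m ->
  weighted_risk P X mu a tau alpha beta =
  (alpha * `|a + m - mu| + beta / n%:R / tau *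
    (\int[P]_w (`|Y i0 w| ^+ 2) - `|m| ^+ 2))%:E.
Proof.
move=> Ym; case: (iidX) => mX ind idX.
have n0 : n%:R != 0 :> R by rewrite pnatr_eq0 -lt0n (leq_ltn_trans _ (ltn_ord i0)).
have mY := strongly_measurable_clip_shift.
pose g x := clip tau (x - a) - m.
have cg : continuous g.
  by move=> x; apply: cvgB; [exact: clip_shift_continuous|exact: cvg_cst].
have gB x : `|g x| <= tau + `|m|.
  by rewrite (le_trans (ler_normB _ _))// lerD2r norm_clip_le.
have Yi i : P.-integrable setT (EFin \o (fun w => `|Y i w|)).
  exact: bounded_integrable (mY i) (YB i).
have gw : weak_mean ip P (g \o X i0) 0.
  move=> z; under eq_Rintegral do rewrite /= ipBl.
  rewrite RintegralB//; [|exact: (integrable_ip ip_norm z (mY i0) (Yi i0))|exact: integrable_cstR].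
  by rewrite (Ym z) Rintegral_cstP subrr ip0l.
have muhatE w : clipped_mean X a tau w = a + m + n%:R^-1 *: \sum_(i < n) g (X i w).
  have -> : \sum_(i < n) g (X i w) = \sum_(i < n) clip tau (X i w - a) - n%:R *: m.
    by rewrite sumrB sumr_const card_ord scaler_nat.
  by rewrite scalerBr scalerA mulVf// scale1r -addrA [m + _]addrC subrK.
have mmuhat : strongly_measurable (clipped_mean X a tau).
  apply: strongly_measurableD; first exact: strongly_measurable_cst.
  by apply: strongly_measurableZ; exact: strongly_measurable_sum.
have sB w : `|n%:R^-1 *: \sum_(i < n) g (X i w)| <= tau + `|m|.
  rewrite normrZ ger0_norm ?invr_ge0// ler_pdivrMl ?lt0r ?n0//=.
  rewrite (le_trans (ler_norm_sum _ _ _))//.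
  rewrite (le_trans (ler_sum _ (fun i _ => gB (X i w))))//.
  by rewrite sumr_const card_ord mulr_natl.
have msum : strongly_measurable (fun w => n%:R^-1 *: \sum_(i < n) g (X i w)).
  apply: strongly_measurableZ; apply: strongly_measurable_sum => i.
  exact: (strongly_measurable_comp cg (mX i)).
have muhatB w : `|clipped_mean X a tau w| <= `|a + m| + (tau + `|m|).
  by rewrite muhatE (le_trans (ler_normD _ _))// lerD2l.
have bm : bochner_mean P (clipped_mean X a tau) = a + m.
  apply: (ip_inj ip_norm) => z.
  rewrite -(has_mean_weak ip_norm (bochner_meanP ip_norm P mmuhat muhatB)).
  have gi i : \int[P]_w ip (g (X i w)) z = 0.
    transitivity (\int[P]_w ip (g (X i0 w)) z); last by rewrite (gw z) ip0l.
    congr fine; apply: (integral_continuous_same_law (psi := fun x => ip (g x) z)) => //.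
      by move=> A; exact: idX.
    exact: continuous_ip_comp.
  have ii i : P.-integrable setT (EFin \o (fun w => ip (g (X i w)) z)).
    have mgX : strongly_measurable (g \o X i) by exact: (strongly_measurable_comp cg (mX i)).
    apply: (integrable_ip ip_norm z mgX).
    exact: (bounded_integrable P mgX (fun w => gB _)).
  under eq_Rintegral do rewrite muhatE ipDl ipZl ip_suml.
  rewrite RintegralD//; [|exact: integrable_cstR|]; last first.
    by apply: integrable_scaleR; exact: integrable_sumR.
  rewrite Rintegral_cstP RintegralZl//; last exact: integrable_sumR.
  by rewrite Rintegral_sum// big1 ?mulr0 ?addr0.
rewrite /weighted_risk bm.
have -> : (fun w => `|clipped_mean X a tau w - (a + m)| ^+ 2) =
    (fun w => `|n%:R^-1 *: \sum_(i < n) g (X i w)| ^+ 2).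
  by apply/funext => w; rewrite muhatE addrAC subrr add0r.
rewrite expectationRE; last first.
  apply: (@integrable_bounded _ _ _ _ _ ((tau + `|m|) ^+ 2)).
    by apply: measurable_funX; exact: measurable_norm.
  by move=> w; rewrite ger0_norm ?exprn_ge0// ler_pXn2r ?nnegrE// addr_ge0// ltW.
rewrite (iid_average_variance iidX cg gB gw) -EFinM -EFinD; congr EFin.
have Y2 : P.-integrable setT (EFin \o (fun w => `|Y i0 w| ^+ 2)).
  apply: (@integrable_bounded _ _ _ _ _ (tau ^+ 2)).
    by apply: measurable_funX; exact: measurable_norm.
  by move=> w; rewrite ger0_norm ?exprn_ge0// ler_pXn2r ?nnegrE ?YB// ltW.
have i2 : P.-integrable setT (EFin \o (fun w => 2 * ip (Y i0 w) m)).
  by apply: integrable_scaleR; exact: (integrable_ip ip_norm m (mY i0) (Yi i0)).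
have -> : \int[P]_w (`|g (X i0 w)| ^+ 2) = \int[P]_w (`|Y i0 w| ^+ 2) - `|m| ^+ 2.
  transitivity (\int[P]_w (`|Y i0 w| ^+ 2 - 2 * ip (Y i0 w) m + `|m| ^+ 2)).
    by apply: eq_Rintegral => w _; rewrite (sqr_normB ip_norm) mulr_natl.
  rewrite RintegralD//; [|exact: integrable_subR|exact: integrable_cstR].
  rewrite RintegralB// RintegralZl//; last first.
    exact: (integrable_ip ip_norm m (mY i0) (Yi i0)).
  by rewrite (Ym m) ip_norm Rintegral_cstP; ring.
by field; rewrite n0 gt_eqF.
Qed.

End risk.
End clipped_risk.

(** * The upper bound *)

Section upper_bound.
Context (R : realType) (H : completeNormedModType R).
Variables (ip : {dot H for (@idfun R)}).
Hypothesis ip_norm : forall x : H, ip x x = `|x| ^+ 2.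

(** Substitute [s = r / tau] and multiply by [tau]. *)
Lemma clipped_scalar_bound_scaled (p alpha b tau r : R) :
  1 < p -> p <= 2 -> 0 <= alpha -> 0 <= b -> 0 < tau -> 0 <= r ->
  alpha * Num.max (r - tau) 0 + b / tau * Num.min r tau ^+ 2 <=
  K_ p alpha b * tau `^ (1 - p) * r `^ p.
Proof.
move=> p1 p2 a0 b0 tau0 r0; have rt0 : 0 <= r / tau by rewrite divr_ge0// ltW.
have rE : r = r / tau * tau by rewrite divfK// gt_eqF.
have := clipped_scalar_bound p1 p2 a0 b0 rt0.
move=> /(ler_wpM2l (ltW tau0)); rewrite rE; set s := r / tau in rt0 rE *.
rewrite mulfK ?gt_eqF//.
have -> : s * tau - tau = (s - 1) * tau by ring.
have -> : Num.max ((s - 1) * tau) 0 = Num.max (s - 1) 0 * tau.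
  by rewrite maxr_pMl ?mul0r// ltW.
have -> : Num.min (s * tau) tau = Num.min s 1 * tau.
  by rewrite minr_pMl ?mul1r// ltW.
rewrite powRM ?(ltW tau0)// powRB ?powRr1 ?(ltW tau0)//; last first.
  by apply/implyP => _; rewrite gt_eqF.
have tp := powR_gt0 p tau0.
set A := Num.max _ _; set B := Num.min _ _; set K := K_ _ _ _; set S := s `^ p.
move=> h; apply: le_trans (le_trans h _); rewrite le_eqVlt; apply/orP; left; apply/eqP.
  by field; rewrite gt_eqF.
by field; rewrite gt_eqF.
Qed.

Context (d : measure_display) (T : measurableType d) (P : probability T R).

(** The bias is at most the mean excess over [tau], and the variance of one
    clipped increment at most its second moment; both bounds are integrals of
    functions of the distance to the anchor, to which the scalar bound applies. *)
Lemma weighted_risk_le (n : nat) (i0 : 'I_n) (X : 'I_n -> T -> H) (mu a : H)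
    (p tau alpha beta : R) :
  1 < p -> p <= 2 -> 0 < tau -> 0 <= alpha -> 0 <= beta ->
  iid_vectors P X -> has_mean P (X i0) mu ->
  (anchored_moment P p a (X i0) < +oo)%E ->
  (weighted_risk P X mu a tau alpha beta <=
    (K_ p alpha (beta / n%:R) * tau `^ (1 - p))%:E * anchored_moment P p a (X i0))%E.
Proof.
move=> p1 p2 tau0 a0 b0 iidX Xmu Mfin; case: (iidX) => mX _ _.
have b0' : 0 <= beta / n%:R by rewrite divr_ge0.
pose Z w := X i0 w - a; pose Y w := clip tau (Z w).
have mZ : strongly_measurable Z.
  by apply: strongly_measurableB; [exact: mX|exact: strongly_measurable_cst].
have mY : strongly_measurable Y.
  by exact: (strongly_measurable_comp (@clip_continuous R H tau tau0) mZ).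
have YB w : `|Y w| <= tau by exact: norm_clip_le.
have Yi := bounded_integrable P mY YB.
have Xi := has_mean_integrable Xmu.
have ma : strongly_measurable (fun _ : T => a) by exact: strongly_measurable_cst.
have ai : P.-integrable setT (EFin \o (fun _ : T => `|a|)) by exact: integrable_cstR.
have Zi := integrable_normB (mX i0) ma Xi ai; rewrite -/Z in Zi.
have mpow : measurable_fun setT (fun w => `|Z w| `^ p).
  exact: (measurableT_comp (measurable_powR p) (measurable_norm mZ)).
have powi : P.-integrable setT (EFin \o (fun w => `|Z w| `^ p)).
  apply/integrableP; split; first exact/measurable_EFinP.
  under eq_integral do rewrite gee0_abs ?lee_fin ?powR_ge0//.
  by move: Mfin; rewrite /anchored_moment unlock.
have [m /(has_mean_weak ip_norm) Ym] := bounded_has_mean ip_norm P mY YB.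
rewrite (weighted_riskE ip_norm iidX tau0 _ _ _ Ym).
rewrite /anchored_moment expectationRE// -EFinM lee_fin.
have Zm : weak_mean ip P Z (mu - a).
  apply: (weak_meanB ip_norm (mX i0) ma Xi ai (has_mean_weak ip_norm Xmu)).
  by move=> z; exact: Rintegral_cstP.
pose e w := Num.max (`|Z w| - tau) 0; pose q w := Num.min `|Z w| tau ^+ 2.
have me : P.-integrable setT (EFin \o e).
  have := integrable_normB mY mZ Yi Zi.
  by under [X in EFin \o X]eq_fun do rewrite norm_clipB//.
have mq : P.-integrable setT (EFin \o q).
  have : P.-integrable setT (EFin \o (fun w => `|Y w| ^+ 2)).
    apply: (@integrable_bounded _ _ _ _ _ (tau ^+ 2)).
      by apply: measurable_funX; exact: measurable_norm.
    by move=> w; rewrite ger0_norm ?exprn_ge0// ler_pXn2r ?nnegrE ?YB// ltW.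
  by under [X in EFin \o X]eq_fun do rewrite norm_clip//.
have bias : `|a + m - mu| <= \int[P]_w e w.
  have := norm_weak_mean ip_norm (strongly_measurableB mY mZ)
    (integrable_normB mY mZ Yi Zi) (weak_meanB ip_norm mY mZ Yi Zi Ym Zm).
  rewrite opprB addrA [m + a]addrC => /le_trans; apply.
  by rewrite le_eqVlt; apply/orP; left; apply/eqP; apply: eq_Rintegral => w _; exact: norm_clipB.
have var : \int[P]_w (`|Y w| ^+ 2) - `|m| ^+ 2 <= \int[P]_w q w.
  apply: le_trans (_ : \int[P]_w (`|Y w| ^+ 2) <= _); first by rewrite gerBl exprn_ge0.
  by rewrite le_eqVlt; apply/orP; left; apply/eqP; apply: eq_Rintegral => w _; rewrite norm_clip.
have bt0 : 0 <= beta / n%:R / tau by rewrite divr_ge0// ltW.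
apply: (le_trans (lerD (ler_wpM2l a0 bias) (ler_wpM2l bt0 var))).
rewrite -!RintegralZl// -RintegralD//; [|exact: integrable_scaleR..].
apply: Rintegral_le; last first.
- by move=> w; exact: clipped_scalar_bound_scaled.
- exact: integrable_scaleR.
- by apply: integrable_addR; exact: integrable_scaleR.
Qed.

End upper_bound.

(** * Independent coin tosses *)

Section coin_tossing.
Context (n : nat).

Definition coins := {ffun 'I_n -> bool}.

HB.instance Definition _ := Finite.on coins.
HB.instance Definition _ := isPointed.Build coins [ffun=> false].
HB.instance Definition _ := @isMeasurable.Build default_measure_display
  coins discrete_measurable discrete_measurable0
  discrete_measurableC discrete_measurableU.

Context (R : realType) (q : {i01 R}).

Definition coin_weight (b : bool) : R := if b then q%:num else 1 - q%:num.

Lemma coin_weight_ge0 b : 0 <= coin_weight b.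
Proof. by case: b; rewrite /coin_weight ?subr_ge0. Qed.

Lemma coin_weights_ge0 (f : coins) : 0 <= \prod_(i < n) coin_weight (f i).
Proof. by apply: prodr_ge0 => i _; exact: coin_weight_ge0. Qed.

(** The law of [n] independent tosses, each true with probability [q], as a
    finite sum of point masses, from which it inherits its measure structure. *)
Definition coin_measure : set coins -> \bar R :=
  msum (fun k => let f := nth point (enum coins) k in
    mscale (NngNum (coin_weights_ge0 f)) (dirac f)) #|coins|.

HB.instance Definition _ := Measure.on coin_measure.

Lemma coin_measureE (A : set coins) :
  coin_measure A = (\sum_(f : coins) (\prod_(i < n) coin_weight (f i)) * \1_A f)%:E.
Proof.
rewrite /coin_measure /msum -sumEFin -[RHS]big_enum /= (big_nth point) -cardE.
rewrite big_mkord; apply: eq_bigr => k _.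
by rewrite /mscale /= diracE indicE EFinM.
Qed.

Definition coin_mean (F : bool -> R) := q%:num * F true + (1 - q%:num) * F false.

Lemma coin_mean_cst (c : R) : coin_mean (fun=> c) = c.
Proof. by rewrite /coin_mean; ring. Qed.

(** Distributivity of the product over the sum of the weights. *)
Lemma coin_measure_rect (E : 'I_n -> set bool) :
  coin_measure [set f : coins | forall i, E i (f i)] =
  (\prod_(i < n) coin_mean \1_(E i))%:E.
Proof.
rewrite coin_measureE; congr EFin.
transitivity (\sum_(f : coins) \prod_(i < n) (coin_weight (f i) * \1_(E i) (f i))).
  apply: eq_bigr => f _; rewrite big_split /=; congr (_ * _).
  rewrite indicE; have [/set_mem Ef|/negP nEf] := boolP (f \in _).
    by rewrite big1// => i _; rewrite indicE mem_set//; exact: Ef.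
  have /existsNP[i Ei] : ~ forall i, E i (f i) by move=> h; apply: nEf; exact: mem_set.
  by rewrite (bigD1 i)//= indicE memNset// mul0r.
rewrite -(bigA_distr_bigA (fun i b => coin_weight b * \1_(E i) b)).
by apply: eq_bigr => i _; rewrite big_bool.
Qed.

Lemma coin_measure_setT : coin_measure setT = 1%E.
Proof.
rewrite (_ : setT = [set f : coins | forall i, (setT : set bool) (f i)]).
  rewrite (coin_measure_rect (fun=> setT)) big1// => i _.
  by rewrite -[RHS](coin_mean_cst 1) /coin_mean !indicE !in_setT.
by apply/seteqP; split.
Qed.

HB.instance Definition _ :=
  @Measure_isProbability.Build _ _ R coin_measure coin_measure_setT.

Lemma coin_measure_coord (i : 'I_n) (E : set bool) :
  coin_measure [set f : coins | E (f i)] = (coin_mean \1_E)%:E.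
Proof.
transitivity (coin_measure [set f : coins | forall j,
    (if j == i then E else setT) (f j)]).
  congr coin_measure; apply/seteqP; split => f /= Ef; first by move=> j; case: eqP => // ->.
  by have := Ef i; rewrite eqxx.
rewrite (coin_measure_rect (fun j => if j == i then E else setT)) (bigD1 i)//= eqxx big1 ?mulr1// => j /negbTE ->.
by rewrite -[RHS](coin_mean_cst 1) /coin_mean !indicE !in_setT.
Qed.

Lemma coin_integrable (F : coins -> R) :
  coin_measure.-integrable setT (EFin \o F).
Proof.
apply: (@integrable_bounded _ _ _ _ _ (\sum_f `|F f|)); first by move=> _ B _.
by move=> f; rewrite (bigD1 f)//= lerDl sumr_ge0.
Qed.

Lemma coin_Rintegral (i : 'I_n) (F : bool -> R) :
  \int[coin_measure]_f F (f i) = coin_mean F.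
Proof.
transitivity (\int[coin_measure]_f
    (F false + (F true - F false) * \1_[set f : coins | f i = true] f)).
  apply: eq_Rintegral => f _; rewrite indicE.
  case: (boolP (f i)) => fi; first by rewrite mem_set//= mulr1 subrKC.
  by rewrite memNset ?mulr0 ?addr0//=; apply/negP.
rewrite RintegralD//; [|exact: coin_integrable..].
rewrite RintegralZl//; last exact: coin_integrable.
rewrite Rintegral_cstP Rintegral_indic//.
rewrite [X in fine X](coin_measure_coord i [set true]) /=.
by rewrite /coin_mean !indicE mem_set// memNset//=; ring.
Qed.

Context (H : completeNormedModType R) (x : bool -> H).

Definition coin_vectors (i : 'I_n) (f : coins) : H := x (f i).

Lemma simple_coin_vectors i : simple_vector (coin_vectors i).
Proof.
split; last by [].
apply: (@sub_finite_set _ _ (x @` setT)); last exact/finite_image/finite_finset.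
by move=> _ [f _ <-]; exists (f i).
Qed.

Lemma iid_coin_vectors : iid_vectors coin_measure coin_vectors.
Proof.
split.
- by move=> i; apply: simple_strongly_measurable; exact: simple_coin_vectors.
- move=> J B _.
  transitivity (coin_measure [set f : coins | forall i,
      (if i \in J then x @^-1` B i else setT) (f i)]).
    congr coin_measure; apply/seteqP; split => f /= h i.
      by case: ifPn => // /h.
    by move=> /= iJ; have := h i; rewrite iJ.
  rewrite (coin_measure_rect (fun i => if i \in J then x @^-1` B i else setT)) [RHS]big_mkcond /= -prodEFin.
  apply: eq_bigr => i _; case: ifP => _.
    by rewrite -(coin_measure_coord i).
  by congr EFin; rewrite -[RHS](coin_mean_cst 1) /coin_mean !indicE !in_setT.
- move=> i j B _; transitivity (coin_mean \1_(x @^-1` B))%:E.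
    exact: (coin_measure_coord i (x @^-1` B)).
  by rewrite -(coin_measure_coord j (x @^-1` B)).
Qed.

End coin_tossing.

(** * Sharpness *)

Section sharpness.
Context (R : realType) (H : completeNormedModType R).
Variables (ip : {dot H for (@idfun R)}).
Hypothesis ip_norm : forall x : H, ip x x = `|x| ^+ 2.
Variables (p : R) (n : nat) (i0 : 'I_n) (tau alpha beta K : R).
Hypotheses (p_gt1 : 1 < p) (tau0 : 0 < tau).
Hypothesis beta0 : 0 <= beta.
Hypothesis K_bound : forall (d : measure_display) (T : measurableType d)
  (P : probability T R) (X : 'I_n -> T -> H) (mu a : H),
  iid_vectors P X -> has_mean P (X i0) mu ->
  (anchored_moment P p a (X i0) < +oo)%E ->
  (weighted_risk P X mu a tau alpha beta <=
    (K * tau `^ (1 - p))%:E * anchored_moment P p a (X i0))%E.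

(** The hypothesis on [K] at the anchor [0], for vectors equal to
    [(s * tau) *: e] with probability [q] and to [0] otherwise: the bias is
    [q * tau * (s - 1)] and the variance of one clipped vector
    [tau ^+ 2 * q * (1 - q)]. *)
Lemma two_point_bound (e : H) (q s : R) : `|e| = 1 -> 0 < q <= 1 -> 1 <= s ->
  alpha * (s - 1) + beta / n%:R * (1 - q) <= K * s `^ p.
Proof.
move=> e1 /andP[q0 q1] s1; pose Q : {i01 R} := Itv01 (ltW q0) q1.
have s0 : 0 < s by lra.
pose x (b : bool) : H := if b then (s * tau) *: e else 0.
pose P : probability (coins n) R := @coin_measure n R Q.
pose X : 'I_n -> coins n -> H := fun i => coin_vectors x i.
have iidX : iid_vectors P X by exact: iid_coin_vectors.
have normc (c : R) : 0 <= c -> `|c *: e| = c by move=> c0; rewrite normrZ e1 mulr1 ger0_norm.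
have xB b : `|x b| <= s * tau.
  by case: b; rewrite /x ?normr0 ?normc// mulr_ge0 ?ltW.
have mX : strongly_measurable (X i0).
  by apply: simple_strongly_measurable; exact: simple_coin_vectors.
have Rint (F : bool -> R) : \int[P]_f F (f i0) = q * F true + (1 - q) * F false.
  exact: (coin_Rintegral Q i0 F).
have Xmu : has_mean P (X i0) ((q * s * tau) *: e).
  have [m Xm] := bounded_has_mean ip_norm P mX (fun f => xB (f i0)).
  suff -> : (q * s * tau) *: e = m by [].
  apply: (ip_inj ip_norm) => z; rewrite -(has_mean_weak ip_norm Xm).
  by rewrite (Rint (fun b => ip (x b) z)) /= ip0l !ipZl; ring.
have Ym : weak_mean ip P (fun f => clip tau (X i0 f - 0)) ((q * tau) *: e).
  move=> z; rewrite (Rint (fun b => ip (clip tau (x b - 0)) z)) !subr0 /=.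
  rewrite !clipE// normr0 scaler0 ip0l normc ?mulr_ge0 ?ltW//.
  rewrite max_r; last by rewrite ler_peMl// ltW.
  by rewrite !ipZl; field; rewrite !gt_eqF.
have Y2 : \int[P]_f (`|clip tau (X i0 f - 0)| ^+ 2) = q * tau ^+ 2.
  rewrite (Rint (fun b => `|clip tau (x b - 0)| ^+ 2)) !subr0 /=.
  rewrite !norm_clip// normr0 normc ?mulr_ge0 ?ltW//.
  rewrite min_r; last by rewrite ler_peMl// ltW.
  by rewrite min_l ?ltW// expr0n /= mulr0 addr0.
have moment : anchored_moment P p 0 (X i0) = (q * (s * tau) `^ p)%:E.
  rewrite /anchored_moment expectationRE; last exact: coin_integrable.
  congr EFin; rewrite (Rint (fun b => `|x b - 0| `^ p)) !subr0 /=.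
  rewrite normr0 normc ?mulr_ge0 ?ltW// powR0 ?mulr0 ?addr0//.
  by rewrite gt_eqF// (lt_trans ltr01).
have := @K_bound _ _ P X _ 0 iidX Xmu.
rewrite moment (weighted_riskE ip_norm iidX tau0 _ _ _ Ym) Y2 ltry => /(_ isT).
rewrite -EFinM lee_fin add0r -scalerBl normrZ e1 mulr1.
have -> : `|(q * tau) *: e| = q * tau by rewrite normc// mulr_ge0// ltW.
have -> : q * tau - q * s * tau = - (q * tau * (s - 1)) by ring.
rewrite normrN ger0_norm; last by rewrite mulr_ge0 ?subr_ge0// mulr_ge0// ltW.
rewrite powRM ?(ltW s0) ?(ltW tau0)// powRB ?powRr1 ?(ltW tau0)//; last first.
  by apply/implyP => _; rewrite gt_eqF.
have tp := powR_gt0 p tau0; have qt : 0 < q * tau by rewrite mulr_gt0.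
move=> h; rewrite -(ler_pM2l qt); apply: le_trans (le_trans h _).
  by rewrite le_eqVlt; apply/orP; left; apply/eqP; field; rewrite !gt_eqF// ltr0n (leq_ltn_trans _ (ltn_ord i0)).
by rewrite le_eqVlt; apply/orP; left; apply/eqP; field; rewrite gt_eqF.
Qed.

(** Let [q] tend to [0] in the two-point bound, at the scale [s] where the
    tangent bound is attained. *)
Lemma K_minimal : (exists x : H, x != 0) -> K_ p alpha (beta / n%:R) <= K.
Proof.
move=> [x x0]; pose e := `|x|^-1 *: x.
have e1 : `|e| = 1 by rewrite normrZ normfV normr_id mulVf// normr_eq0.
have b0 : 0 <= beta / n%:R by rewrite divr_ge0.
set b := beta / n%:R in b0 *.
have [s s1 sK] := tangent_attained alpha p_gt1 b0.
have s0 : 0 < s `^ p by rewrite powR_gt0//; lra.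
rewrite -(ler_pM2r s0) -sK leNgt; apply/negP; set k := K * _ => lt_k.
(* this q makes the loss b * q smaller than the gap D *)
pose D := alpha * (s - 1) + b - k; have D0 : 0 < D by rewrite subr_gt0.
have S0 : 0 < D + b + 1 by lra.
have := @two_point_bound e (D / (D + b + 1)) s e1 _ s1; rewrite -/b -/k.
rewrite divr_gt0//= ler_pdivrMr// mul1r => /(_ ltac:(lra)).
suff : b * (D / (D + b + 1)) < D by rewrite /D; lra.
by rewrite mulrA ltr_pdivrMr//; nra.
Qed.

End sharpness.

Theorem corollary5p3 (R : realType) (H : completeNormedModType R)
    (ip : {dot H for (@idfun R)}) (ip_norm : forall x : H, ip x x = `|x| ^+ 2)
    (H_nonzero : exists x : H, x != 0)
    (p : R) (p_gt1 : 1 < p) (p_le2 : p <= 2)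
    (n : nat) (n_ge1 : (0 < n)%N) (tau : R) (tau_gt0 : 0 < tau) :
  [/\ (* upper bound *)
      forall (d : measure_display) (T : measurableType d) (P : probability T R)
        (X : 'I_n -> T -> H) (mu a : H),
        iid_vectors P X ->
        has_mean P (X (Ordinal n_ge1)) mu ->
        (anchored_moment P p a (X (Ordinal n_ge1)) < +oo)%E ->
        forall alpha beta : R, 0 <= alpha -> 0 <= beta ->
          (weighted_risk P X mu a tau alpha beta <=
             (K_ p alpha (beta / n%:R) * tau `^ (1 - p))%:E *
             anchored_moment P p a (X (Ordinal n_ge1)))%E,
      (* sharpness *)
      forall alpha beta : R, 0 <= alpha -> 0 <= beta ->
        forall K : R,
          (forall (d : measure_display) (T : measurableType d)
             (P : probability T R) (X : 'I_n -> T -> H) (mu a : H),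
             iid_vectors P X ->
             has_mean P (X (Ordinal n_ge1)) mu ->
             (anchored_moment P p a (X (Ordinal n_ge1)) < +oo)%E ->
             (weighted_risk P X mu a tau alpha beta <=
                (K * tau `^ (1 - p))%:E *
                anchored_moment P p a (X (Ordinal n_ge1)))%E) ->
          K_ p alpha (beta / n%:R) <= K
    & (* phase boundary *)
      phase_boundary p n =
        [set x | [/\ 0 <= x.1, 0 <= x.2 & x.1 = p * x.2 / n%:R]] ].
Proof.
split.
- move=> d T P X mu a iidX Xmu Mfin alpha beta a0 b0.
  exact: weighted_risk_le.
- move=> alpha beta _ b0 K K_bound; exact: (K_minimal ip_norm p_gt1 tau_gt0 b0 K_bound H_nonzero).
- by apply: phase_boundaryE => //; lra.
Qed.
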